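(* Let $\lambda>0$ and $(f_0,g_0)\in L^1_+(\mathbb{R})\times L^1_+(\mathbb{R}^2)$. Then the initial value problem $$\partial_tf=2\left(2\bar g-\lambda f\int_{\mathbb{R}}f(\varphi_*,t)\,\mathrm{d}\varphi_*\right),\qquad \bar g(\varphi,t)=g(\varphi,\varphi,t),$$ $$\partial_tg+\nabla\cdot(v_2g)=\lambda f(\varphi,t)f(\varphi_*,t),\qquad \varphi\ne\varphi_*,$$ $$f(\varphi,0)=f_0(\varphi),\qquad g(\varphi,\varphi_*,0)=g_0(\varphi,\varphi_* ),$$ has a unique mild solution $(f,g)\in L^\infty\big((0,\infty);L^1_+(\mathbb{R})\times L^1_+(\mathbb{R}^2)\big)$, where mild solution means that the following two equations hold: $$f(\varphi,t)=F_f(0,t)f_0(\varphi)+4\int_0^tF_f(s,t)\,g_0\left(\varphi+\tfrac s2,\varphi-\tfrac s2\right)\mathrm{d}s+4\lambda\int_0^tF_f(s,t)\int_0^sf\left(\varphi+\tfrac{s-r}2,r\right)f\left(\varphi-\tfrac{s-r}2,r\right)\mathrm{d}r\,\mathrm{d}s,$$ $$g(\varphi,\varphi_*,t)=g_0\big(\Phi^{-t}(\varphi,\varphi_* ),\Phi^{-t}_*(\varphi,\varphi_* )\big)+\lambda\int_0^tf\big(\Phi^{s-t}(\varphi,\varphi_* ),s\big)f\big(\Phi_*^{s-t}(\varphi,\varphi_* ),s\big)\,\mathrm{d}s.$$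
   Context: $L^1_+$ denotes the set of (a.e.) nonnegative functions in $L^1$. Here $\varphi,\varphi_*\in\mathbb{R}$, $t>0$, $\nabla=(\partial_\varphi,\partial_{\varphi_*})$, $v_2(\varphi,\varphi_* )=\frac{\operatorname{sgn}(\varphi-\varphi_* )}{2}(-1,1)$, $$F_f(s,t)=\exp\left(-2\lambda\int_s^tM_f(r)\,\mathrm{d}r\right),\qquad M_f(t)=\int_{\mathbb{R}}f(\varphi,t)\,\mathrm{d}\varphi,$$ and for $t\ge0$ $$\Phi^{-t}(\varphi,\varphi_* )=\varphi+\frac t2\operatorname{sgn}(\varphi-\varphi_* ),\qquad \Phi^{-t}_*(\varphi,\varphi_* )=\varphi_*-\frac t2\operatorname{sgn}(\varphi-\varphi_* ).$$ In the differential formulation the term $2\bar g$ is interpreted as the sum of the two traces of $g$ on the diagonal $\{\varphi=\varphi_*\}$ from $\varphi>\varphi_*$ and $\varphi<\varphi_*$. *)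

(* Defs.v *)
From HB Require Import structures.
From mathcomp Require Import all_boot all_order all_algebra.
From mathcomp Require Import all_classical all_reals all_analysis.

Set Implicit Arguments.
Unset Strict Implicit.
Unset Printing Implicit Defensive.
Import Order.TTheory GRing.Theory Num.Theory.
Import numFieldNormedType.Exports.

Local Open Scope classical_set_scope.
Local Open Scope ring_scope.

(* Elements of L^1 and of L^oo((0,oo); L^1) are given by Borel representatives;
   functions of time and space take the time variable first: f t phi and
   g t (phi, phi_star). *)

Notation leb R := (@lebesgue_measure R) (only parsing).

Notation leb2 R := (@lebesgue_measure R \x @lebesgue_measure R)%E (only parsing).

Definition L1_plus (d : measure_display) (T : measurableType d) (R : realType)
    (mu : {measure set T -> \bar R}) (u : T -> R) : Prop :=
  u \in Lfun mu 1 /\ {ae mu, forall x, 0 <= u x}.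

(* Joint measurability picks, for a class in the Bochner space, a representative
   for which the integrals along characteristics in the mild equations make
   sense; values at times t <= 0 are irrelevant. *)
Definition Linfty_L1_plus (d : measure_display) (T : measurableType d)
    (R : realType) (mu : {measure set T -> \bar R}) (u : R -> T -> R) : Prop :=
  [/\ measurable_fun [set p : measurableTypeR R * T | 0 < p.1]
        (fun p => u p.1 p.2),
      {ae leb R, forall t, 0 < t -> L1_plus mu (u t)} &
      exists C : R,
        {ae leb R, forall t, 0 < t -> ('N[mu]_1[EFin \o u t] <= C%:E)%E}].

Definition eq_Linfty_L1 (d : measure_display) (T : measurableType d)
    (R : realType) (mu : {measure set T -> \bar R}) (u v : R -> T -> R) : Prop :=
  {ae leb R, forall t, 0 < t -> u t = v t %[ae mu]}.

Definition mass (R : realType) (f : R -> R -> R) (t : R) : R :=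
  \int[leb R]_phi f t phi.

Definition damping (R : realType) (lambda : R) (f : R -> R -> R) (s t : R) : R :=
  expR (- 2 * lambda * \int[leb R]_(r in `[s, t]) mass f r).

(* For 0 <= t, the pair (Phi^{-t}, Phi_*^{-t}). *)
Definition back_flow (R : realType) (t : R) (p : R * R) : R * R :=
  (p.1 + t / 2 * Num.sg (p.1 - p.2), p.2 - t / 2 * Num.sg (p.1 - p.2)).

(* The time integrals are extended-real valued, so that the equations include
   the finiteness of their right-hand sides.  They are equations in
   L^oo((0,oo); L^1), hence hold for a.e. t > 0, almost everywhere in space. *)
Definition mild_f (R : realType) (lambda : R) (f0 : R -> R) (g0 : R * R -> R)
    (f : R -> R -> R) : Prop :=
  {ae leb R, forall t, 0 < t -> {ae leb R, forall phi,
    (f t phi)%:E =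
      ((damping lambda f 0 t * f0 phi)%:E
       + 4%:E * \int[leb R]_(s in `[0%R, t])
           (damping lambda f s t * g0 (phi + s / 2, phi - s / 2))%:E
       + (4 * lambda)%:E * \int[leb R]_(s in `[0%R, t])
           ((damping lambda f s t)%:E *
            \int[leb R]_(r in `[0%R, s])
              (f r (phi + (s - r) / 2) * f r (phi - (s - r) / 2))%:E))%E}}.

Definition mild_g (R : realType) (lambda : R) (g0 : R * R -> R)
    (f : R -> R -> R) (g : R -> R * R -> R) : Prop :=
  {ae leb R, forall t, 0 < t -> {ae leb2 R, forall p,
    (g t p)%:E =
      ((g0 (back_flow t p))%:E
       + lambda%:E * \int[leb R]_(s in `[0%R, t])
           (f s (back_flow (t - s) p).1 * f s (back_flow (t - s) p).2)%:E)%E}}.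

Definition mild_solution (R : realType) (lambda : R)
    (f0 : R -> R) (g0 : R * R -> R)
    (f : R -> R -> R) (g : R -> R * R -> R) : Prop :=
  [/\ Linfty_L1_plus (leb R) f, Linfty_L1_plus (leb2 R) g,
      mild_f lambda f0 g0 f & mild_g lambda g0 f g].

(* Main.v *)
Require Import Defs.
From mathcomp Require Import all_boot all_order all_algebra.
From mathcomp Require Import all_classical all_reals all_analysis.
From mathcomp Require Import measurable_realfun ring lra.
Import Order.TTheory GRing.Theory Num.Theory.
Import numFieldNormedType.Exports.

(** The function [g] enters the first equation only through [g0], so [f] alone
    solves a fixed point equation [f = mild f], and the second equation is then
    a formula for [g].  Everything is done with integrals in [[0, +oo]], where
    Tonelli's theorem and translations replace all changes of variables.

    _Local theory._  The source of [f] counts pairs when they meet.  Integrated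
    over space and time it is the mass of those pairs whose gap is small enough
    to be closed in the time available ([int_collision], [int_g0_le]).  Hence the
    part created by encounters is at most the time integral of the squared
    mass, and as it is bilinear, on densities of mass at most [C]
      [dist1 (mild f) (mild h) t <= L * \int_0^t dist1 f h]
    ([mild_map_contract]).  Iterating such a Volterra inequality gives
    geometric decay ([volterra_decay]), which yields both convergence of Picard
    iterates and uniqueness.

    _Global existence._  The mass is first truncated at a level [K], which makes
    the map Lipschitz on all densities and gives a fixed point [f] of
    [mild (truncate K f)] for all times.  Its mass obeys the a priori bound
    [M0 + 4 N0]: mass is lost at rate [2 lambda mass ^ 2], and each pair formed
    on one side of the diagonal returns mass with weight [4 lambda] once it has
    met.  The pairs that have met and the pairs still free together fill one
    half plane, that is half of all ordered pairs ([pair_budget]), so the gain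
    never exceeds the loss ([mild_budget]).  With [K] above this bound the
    truncation is inactive ([exists_mild_density]).  The same balance bounds the
    free pairs, which are the mass of the created part of [g] ([int_created]).

    _Representatives._  The equations hold almost everywhere and integrate
    along characteristics, whereas [f0], [g0] and an unknown solution are only
    given up to null sets.  Since the flow acts by translations on each side of
    the diagonal, a null set meets almost every characteristic in a null set
    of times, so the right-hand sides depend on the classes only
    ([density_rhs_eq], [pair_rhs_eq]). *)

Set Implicit Arguments.
Unset Strict Implicit.
Unset Printing Implicit Defensive.
Local Open Scope classical_set_scope.
Local Open Scope ring_scope.
Local Open Scope ereal_scope.

(** * Measurability and almost everywhere statements *)

Lemma measurable_apply2 (d : measure_display) (T : measurableType d)
    (R : realType) (f : R -> R -> R) (a b : T -> R) :
  measurable_fun setT (fun p : R * R => f p.1 p.2) ->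
  measurable_fun setT a -> measurable_fun setT b ->
  measurable_fun setT (fun x => f (a x) (b x)).
Proof.
by move=> mf ma mb; exact: (measurableT_comp mf (measurable_fun_pair ma mb)).
Qed.

Lemma emeasurable_apply2 (d : measure_display) (T : measurableType d)
    (R : realType) (f : R -> R -> \bar R) (a b : T -> R) :
  measurable_fun setT (fun p : R * R => f p.1 p.2) ->
  measurable_fun setT a -> measurable_fun setT b ->
  measurable_fun setT (fun x => f (a x) (b x)).
Proof.
by move=> mf ma mb; exact: (measurableT_comp mf (measurable_fun_pair ma mb)).
Qed.

Ltac mapply2 f a b H :=
  let T := type of f in
  lazymatch T with
  | _ -> _ -> extended _ => apply: (@emeasurable_apply2 _ _ _ f a b H)
  | _ => apply: (@measurable_apply2 _ _ _ f a b H)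
  end.
(** One structural step of a measurability proof.  Heads are compared with
    [constr_eq] since unification up to conversion would unfold integrals. *)
Ltac mstep :=
  match goal with
  | |- forall _, _ => intro
  | H : measurable_fun _ ?f |- measurable_fun _ ?g => constr_eq f g; exact: H
  | |- measurable_fun _ (fun x => x) => exact: measurable_id
  | |- measurable_fun _ (fun _ => ?c) => exact: measurable_cst
  | |- measurable_fun _ (fun x => (_)%:E) => apply/measurable_EFinP
  | |- measurable_fun _ fst => exact: measurable_fst
  | |- measurable_fun _ snd => exact: measurable_snd
  | |- measurable_fun _ (fun x => fst _) =>
      apply: (measurableT_comp measurable_fst)
  | |- measurable_fun _ (fun x => snd _) =>
      apply: (measurableT_comp measurable_snd)
  | |- measurable_fun _ (fun x => (_ + - _)%R) => apply: measurable_funB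
  | |- measurable_fun _ (fun x => (_ + _)%R) => apply: measurable_funD
  | |- measurable_fun _ (fun x => (_ * _)%R) => apply: measurable_funM
  | |- measurable_fun _ (fun x => (- _)%R) =>
      apply: (measurableT_comp (@oppr_measurable _ setT))
  | |- measurable_fun _ (fun x => (`| _ |)%R) =>
      apply: (measurableT_comp (@normr_measurable _ setT))
  | |- measurable_fun _ (fun x => expR _) =>
      apply: (measurableT_comp (@measurable_expR _))
  | |- measurable_fun _ (fun x => fine _) =>
      apply: (measurableT_comp (@fine_measurable _ _ measurableT))
  | |- measurable_fun _ (fun x => `| _ |) =>
      apply: (measurableT_comp (@abse_measurable _ setT))
  | |- measurable_fun _ (fun x => @Algebra.add _ _ _) =>
      apply: emeasurable_funD
  | |- measurable_fun _ (fun x => _ * _) => apply: emeasurable_funM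
  | |- measurable_fun _ (fun x => if _ then _ else _) =>
      apply: measurable_fun_ifT
  | |- measurable_fun _ (fun x => (_ <= _)%R && (_ <= _)%R) =>
      apply: measurable_and
  | |- measurable_fun _ (fun x => (_ <= _)%R) => apply: measurable_fun_ler
  | |- measurable_fun _ (fun x => (_ < _)%R) => apply: measurable_fun_ltr
  | |- measurable_fun _ (fun x => (Num.max _ _)%R) => apply: measurable_maxr
  | H : measurable_fun setT (fun p => ?f p.1 p.2)
    |- measurable_fun _ (fun x => ?g (@?a x) (@?b x)) =>
      constr_eq f g; mapply2 f a b H
  | H : measurable_fun setT (fun p => ?f p.1 p.2)
    |- @measurable_fun _ _ ?T _ _ (?g ?y) =>
      constr_eq f g; mapply2 f (fun _ : T => y) (fun x : T => x) H
  | H : measurable_fun setT ?f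
    |- measurable_fun _ (fun x => ?g _) =>
      constr_eq f g; apply: (measurableT_comp H)
  | |- measurable_fun ?D (Order.le ?y) =>
      change (measurable_fun D (fun x => (y <= x)%R))
  | |- measurable_fun ?D (Order.lt ?y) =>
      change (measurable_fun D (fun x => (y < x)%R))
  | |- measurable_fun ?D (GRing.add ?y) =>
      change (measurable_fun D (fun x => (y + x)%R))
  | |- measurable_fun ?D (GRing.mul ?y) =>
      change (measurable_fun D (fun x => (y * x)%R))
  | |- measurable_fun _ (fun x => (_, _)) => apply: measurable_fun_pair
  end.
Ltac meas := repeat (cbv beta; mstep).

Section AlmostEverywhere.
Context d (T : measurableType d) (R : realType) (m : {measure set T -> \bar R}).
Implicit Types P Q S : T -> Prop.

Lemma ae_imply P Q : (forall x, P x -> Q x) ->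
  {ae m, forall x, P x} -> {ae m, forall x, Q x}.
Proof. by move=> PQ H; exact: (filterS PQ H). Qed.

Lemma ae_imply2 P Q S : (forall x, P x -> Q x -> S x) ->
  {ae m, forall x, P x} -> {ae m, forall x, Q x} -> {ae m, forall x, S x}.
Proof.
move=> PQS mP mQ; apply: (@ae_imply (fun x => P x /\ Q x)).
  by move=> x []; exact: PQS.
exact: (filterI mP mQ).
Qed.

End AlmostEverywhere.

(** * Tonelli and translations on the line *)

Section Calculus.
Context {R : realType}.
Local Notation mu := (@lebesgue_measure R).
Implicit Types (a b c t : R).

Lemma measurable_pint (d : measure_display) (T : measurableType d)
    (k : T -> R -> \bar R) :
  measurable_fun setT (fun p : T * R => k p.1 p.2) ->
  (forall x y, 0 <= k x y) ->
  measurable_fun setT (fun x => \int[mu]_y k x y).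
Proof.
move=> mk k0.
exact: (@measurable_fun_fubini_tonelli_F _ _ _ _ _ mu
  (fun p : T * R => k p.1 p.2)).
Qed.

Lemma integral_itv_if a b (h : R -> \bar R) :
  \int[mu]_(s in `[a, b]) h s = \int[mu]_s (if (a <= s <= b)%R then h s else 0).
Proof.
rewrite integral_mkcond; apply: eq_integral => s _.
by rewrite patchE mem_setE in_itv.
Qed.

Lemma measurable_pint_itv (d : measure_display) (T : measurableType d)
    (lo hi : T -> R) (k : T -> R -> \bar R) :
  measurable_fun setT lo -> measurable_fun setT hi ->
  measurable_fun setT (fun p : T * R => k p.1 p.2) ->
  (forall x y, 0 <= k x y) ->
  measurable_fun setT (fun x => \int[mu]_(y in `[lo x, hi x]) k x y).
Proof.
move=> mlo mhi mk k0; under eq_fun do rewrite integral_itv_if.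
apply: measurable_pint; first by meas.
by move=> x y; case: ifP.
Qed.

Lemma tonelli_swap (k : R -> R -> \bar R) :
  measurable_fun setT (fun p : R * R => k p.1 p.2) ->
  (forall x y, 0 <= k x y) ->
  \int[mu]_x \int[mu]_y k x y = \int[mu]_y \int[mu]_x k x y.
Proof.
by move=> mk k0; exact: (@fubini_tonelli _ _ _ _ _ mu mu (fun p => k p.1 p.2)).
Qed.

(** Both sides give an interval its length, which determines the measure. *)
Lemma lebesgue_measure_translation c (A : set R) : measurable A ->
  pushforward mu ((fun x => x + c)%R : _ -> measurableTypeR R) A = mu A.
Proof.
have mf : measurable_fun [set: R] ((fun x => x + c)%R : _ -> measurableTypeR R).
  by apply: measurable_funD.
move=> mA; apply/esym/lebesgue_measure_unique => //= _ [[u v]] _ <-.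
rewrite /pushforward/=.
have -> : (fun x => x + c)%R @^-1` `]u, v]%classic = `](u - c)%R, (v - c)%R]%classic.
  by apply/seteqP; split => x /=; rewrite !in_itv/= ltrBlDr lerBrDr.
rewrite !lebesgue_measure_itv/= !lte_fin ltrD2r.
by case: ifP => // _; rewrite -!EFinD; congr EFin; ring.
Qed.

Lemma integral_translation c (h : R -> \bar R) :
  measurable_fun setT h -> (forall x, 0 <= h x) ->
  \int[mu]_x h (x + c)%R = \int[mu]_x h x.
Proof.
move=> mh h0; pose phi (x : measurableTypeR R) : measurableTypeR R := (x + c)%R.
have mf : measurable_fun setT phi by apply: measurable_funD.
rewrite -(@ge0_integral_pushforward _ _ _ _ _ _ mf mu setT h)//.
apply: eq_measure_integral => A mA _.
exact: lebesgue_measure_translation.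
Qed.

Lemma ge0_integralZ (k : R) (D : set R) (h : R -> \bar R) : measurable D ->
  measurable_fun setT h -> (forall x, 0 <= h x) -> (0 <= k)%R ->
  \int[mu]_(x in D) (k%:E * h x) = k%:E * \int[mu]_(x in D) h x.
Proof.
by move=> mD mh h0 k0; rewrite ge0_integralZl// ; exact: measurable_funTS.
Qed.

Lemma tonelli_itv a b (k : R -> R -> \bar R) :
  measurable_fun setT (fun p : R * R => k p.1 p.2) ->
  (forall x y, 0 <= k x y) ->
  \int[mu]_x \int[mu]_(s in `[a, b]) k s x =
  \int[mu]_(s in `[a, b]) \int[mu]_x k s x.
Proof.
move=> mk k0; rewrite integral_itv_if.
under eq_integral do rewrite integral_itv_if.
rewrite (tonelli_swap (k := fun x s => if (a <= s <= b)%R then k s x else 0)).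
- by apply: eq_integral => s _; case: ifP => // _; rewrite integral0.
- by meas.
- by move=> x s; case: ifP.
Qed.

Lemma tonelli_triangle t (k : R -> R -> \bar R) :
  measurable_fun setT (fun p : R * R => k p.1 p.2) ->
  (forall x y, 0 <= k x y) ->
  \int[mu]_(s in `[0%R, t]) \int[mu]_(r in `[0%R, s]) k s r =
  \int[mu]_(r in `[0%R, t]) \int[mu]_(s in `[r, t]) k s r.
Proof.
move=> mk k0; rewrite !integral_itv_if.
pose K s r := if (0 <= r <= s)%R && (r <= s <= t)%R then k s r else 0.
transitivity (\int[mu]_s \int[mu]_r K s r).
  apply: eq_integral => s _; rewrite /K integral_itv_if; case: ifPn => [/andP[s0 st]|st].
    apply: eq_integral => r _; rewrite st andbT.
    by case: (0 <= r)%R; case: (r <= s)%R.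
  rewrite integral0_eq// => r _; case: ifP => // /andP[/andP[r0 rs] /andP[_ st']].
  by rewrite (le_trans r0 rs) st' in st.
rewrite tonelli_swap; last 2 first.
- rewrite /K; apply: measurable_fun_ifT; [apply: measurable_and|by meas|by meas]; by meas.
- by move=> x y; rewrite /K; case: ifP.
apply: eq_integral => r _; rewrite /K integral_itv_if; case: ifPn => [/andP[r0 rt]|rt].
  by apply: eq_integral => s _; rewrite r0/=; case: (r <= s)%R.
rewrite [LHS]integral0_eq// => s _; case: ifP => // /andP[/andP[r0 rs] /andP[_ st]].
by rewrite r0 (le_trans rs st) in rt.
Qed.

Lemma ge0_integral_itvD a b (h1 h2 : R -> \bar R) :
  measurable_fun setT h1 -> measurable_fun setT h2 ->
  (forall x, 0 <= h1 x) -> (forall x, 0 <= h2 x) ->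
  \int[mu]_(x in `[a, b]) (h1 x + h2 x) =
  \int[mu]_(x in `[a, b]) h1 x + \int[mu]_(x in `[a, b]) h2 x.
Proof. by move=> m1 m2 p1 p2; apply: ge0_integralD => //; exact: measurable_funTS. Qed.

Lemma ge0_iterated_integralD (h1 h2 : R -> R -> \bar R) :
  measurable_fun setT (fun p : R * R => h1 p.1 p.2) ->
  measurable_fun setT (fun p : R * R => h2 p.1 p.2) ->
  (forall x y, 0 <= h1 x y) -> (forall x y, 0 <= h2 x y) ->
  \int[mu]_x \int[mu]_y (h1 x y + h2 x y) =
  \int[mu]_x \int[mu]_y h1 x y + \int[mu]_x \int[mu]_y h2 x y.
Proof.
move=> m1 m2 p1 p2.
transitivity (\int[mu]_x (\int[mu]_y h1 x y + \int[mu]_y h2 x y)).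
  by apply: eq_integral => x _; apply: ge0_integralD => //; meas.
apply: ge0_integralD => //.
- by move=> x _; exact: integral_ge0.
- exact: measurable_pint.
- by move=> x _; exact: integral_ge0.
- exact: measurable_pint.
Qed.

Section double_integrals.
Variables (t : R) (h1 h2 : R -> R -> \bar R).
Hypotheses (m1 : measurable_fun setT (fun p : R * R => h1 p.1 p.2)).
Hypotheses (m2 : measurable_fun setT (fun p : R * R => h2 p.1 p.2)).
Hypotheses (h1_ge0 : forall s x, 0 <= h1 s x) (h2_ge0 : forall s x, 0 <= h2 s x).

Let mI1 : measurable_fun setT (fun s => \int[mu]_x h1 s x).
Proof. exact: measurable_pint. Qed.
Let mI2 : measurable_fun setT (fun s => \int[mu]_x h2 s x).
Proof. exact: measurable_pint. Qed.

Lemma int2D : \int[mu]_(s in `[0%R, t]) \int[mu]_x (h1 s x + h2 s x) =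
  \int[mu]_(s in `[0%R, t]) \int[mu]_x h1 s x +
  \int[mu]_(s in `[0%R, t]) \int[mu]_x h2 s x.
Proof.
rewrite -ge0_integralD//; first last.
- exact: measurable_funTS.
- by move=> s _; exact: integral_ge0.
- exact: measurable_funTS.
- by move=> s _; exact: integral_ge0.
by apply: eq_integral => s _; rewrite ge0_integralD//; meas.
Qed.

Lemma int2Z (k : \bar R) : 0 <= k ->
  \int[mu]_(s in `[0%R, t]) \int[mu]_x (k * h1 s x) =
  k * \int[mu]_(s in `[0%R, t]) \int[mu]_x h1 s x.
Proof.
move=> k0; rewrite -ge0_integralZl//; last 2 first.
- exact: measurable_funTS.
- by move=> s _; exact: integral_ge0.
by apply: eq_integral => s _; rewrite ge0_integralZl//; meas.
Qed.

End double_integrals.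

End Calculus.

(** * Pairs that meet *)

Section Collision.
Context {R : realType}.
Local Notation mu := (@lebesgue_measure R).
Local Notation jmeas f := (measurable_fun setT (fun p : R * R => f p.1 p.2)).

(** A pair created at time [r] with gap [s - r] closes it at unit relative
    speed, so it meets at its midpoint [x] at time [s]. *)
Definition collision (u v : R -> R -> R) (s x : R) : \bar R :=
  \int[mu]_(r in `[0%R, s])
    (u r (x + (s - r) / 2) * v r (x - (s - r) / 2))%:E.

Section two_densities.
Variables u v : R -> R -> R.
Hypotheses (mu_ : jmeas u) (mv : jmeas v).
Hypotheses (u0 : forall t x, (0 <= u t x)%R) (v0 : forall t x, (0 <= v t x)%R).

Lemma collision_ge0 s x : 0 <= collision u v s x.
Proof. by apply: integral_ge0 => r _; rewrite lee_fin mulr_ge0. Qed.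

Lemma measurable_collision : measurable_fun setT (fun p : R * R => collision u v p.1 p.2).
Proof.
apply: measurable_pint_itv; [by meas|by meas|by meas|].
by move=> x y; rewrite lee_fin mulr_ge0.
Qed.

(** Change of variables from the meeting point and time to the two positions
    at the creation time [r]: a pair with [y <= x] meets before [t] exactly
    when its gap is at most [t - r].  This region has unit Jacobian, so it is
    handled by two translations and Tonelli. *)
Lemma int_collision t :
  \int[mu]_(s in `[0%R, t]) \int[mu]_x collision u v s x =
  \int[mu]_(r in `[0%R, t]) \int[mu]_y
    \int[mu]_(x in `[y, (y + (t - r))%R]) (u r x * v r y)%:E.
Proof.
have k0 r a b : 0 <= (u r a * v r b)%:E by rewrite lee_fin mulr_ge0.
under eq_integral => s _.
  rewrite /collision (@tonelli_itv _ _ _ (fun r x =>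
    (u r (x + (s - r) / 2) * v r (x - (s - r) / 2))%:E)) //; last by meas.
  over.
rewrite (@tonelli_triangle _ _ (fun s r => \int[mu]_x
    (u r (x + (s - r) / 2) * v r (x - (s - r) / 2))%:E)); last 2 first.
- by apply: measurable_pint => //; meas.
- by move=> *; exact: integral_ge0.
apply: eq_integral => r _.
transitivity (\int[mu]_(s in `[r, t]) \int[mu]_y (u r (s + (y - r)) * v r y)%:E).
  apply: eq_integral => s _.
  rewrite -(@integral_translation _ (- ((s - r) / 2))
    (fun y => (u r (s + (y - r)) * v r y)%:E))//; last by meas.
  by apply: eq_integral => x _; congr (u r _ * _)%:E; field.
pose k (s y : R) : \bar R := (u r (s + (y - r)) * v r y)%:E.
have mk : jmeas k by rewrite /k; meas.
rewrite -(tonelli_itv r t mk (fun s y => k0 r (s + (y - r))%R y)).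
apply: eq_integral => y _; rewrite !integral_itv_if.
rewrite -(@integral_translation _ (y - r)
   (fun x => if (y <= x <= y + (t - r))%R then (u r x * v r y)%:E else 0)); last 2 first.
- by meas.
- by move=> x; case: ifP.
apply: eq_integral => s _; congr (if _ then _ else _).
by congr andb; apply/idP/idP; lra.
Qed.

Lemma int_collision_le t :
  \int[mu]_(s in `[0%R, t]) \int[mu]_x collision u v s x <=
  \int[mu]_(r in `[0%R, t])
    ((\int[mu]_x (u r x)%:E) * \int[mu]_y (v r y)%:E).
Proof.
have k0 r a b : 0 <= (u r a * v r b)%:E by rewrite lee_fin mulr_ge0.
have I0 r : 0 <= \int[mu]_x (u r x)%:E by apply: integral_ge0 => x _; rewrite lee_fin.
have J0 r : 0 <= \int[mu]_x (v r x)%:E by apply: integral_ge0 => x _; rewrite lee_fin.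
rewrite int_collision; apply: ge0_le_integral => //.
- by move=> r _; apply: integral_ge0 => y _; exact: integral_ge0.
- apply: measurable_funTS; apply: measurable_pint.
    by apply: measurable_pint_itv => //; meas.
  by move=> *; exact: integral_ge0.
- apply: measurable_funTS; apply: emeasurable_funM; apply: measurable_pint; try by meas.
  + by move=> *; rewrite lee_fin.
  + by move=> *; rewrite lee_fin.
move=> r _; rewrite -ge0_integralZl//; last 2 first.
- by meas.
- by move=> y _; rewrite lee_fin.
apply: ge0_le_integral => //.
- by move=> *; exact: integral_ge0.
- by apply: measurable_pint_itv => //; meas.
- by meas.
move=> y _; rewrite -ge0_integralZr//; last 3 first.
- by meas.
- by move=> x _; rewrite lee_fin.
- by rewrite lee_fin.
under [leRHS]eq_integral do rewrite -EFinM.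
by apply: ge0_subset_integral => //; meas.
Qed.

End two_densities.
End Collision.

(** * Half planes and exponential damping *)

Section HalfPlane.
Context {R : realType}.
Local Notation mu := (@lebesgue_measure R).
Variable w : R -> R.
Hypotheses (mw : measurable_fun setT w) (w0 : forall x, (0 <= w x)%R).

Let W : \bar R := \int[mu]_x (w x)%:E.

(** The half planes on both sides of the diagonal carry equal mass by symmetry. *)
Lemma half_plane_mass :
  \int[mu]_y \int[mu]_x (if (y <= x)%R then (w x * w y)%:E else 0) +
  \int[mu]_y \int[mu]_x (if (y <= x)%R then (w x * w y)%:E else 0) = W * W.
Proof.
have ww0 (b : bool) x y : 0 <= (if b then (w x * w y)%:E else 0).
  by case: b => //; rewrite lee_fin mulr_ge0.
rewrite {2}tonelli_swap => [|//|//]; last by meas.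
rewrite -ge0_integralD//; first last.
- by apply: measurable_pint => //; meas.
- by move=> y _; exact: integral_ge0.
- by apply: measurable_pint => //; meas.
- by move=> y _; exact: integral_ge0.
transitivity (\int[mu]_y ((w y)%:E * W)).
  apply: eq_integral => y _.
  rewrite -ge0_integralD//; [|by meas..].
  rewrite -ge0_integralZl//; last 3 first.
  - by meas.
  - by move=> x _; rewrite lee_fin.
  - by rewrite lee_fin.
  (* the two closed half lines only share the point y *)
  apply: ge0_ae_eq_integral => //.
  - by meas.
  - by meas.
  - by move=> x _; rewrite adde_ge0.
  - by move=> x _; rewrite mule_ge0// lee_fin.
  exists [set y]; split => //; first exact: lebesgue_measure_set1.
  move=> x /= /not_implyP[_]; apply: contra_notP => xy.
  have {}xy : x != y by apply/eqP.
  case: (ltgtP y x) xy => // [yx _|xy _].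
  - by rewrite adde0 EFinM muleC.
  - by rewrite add0e EFinM.
rewrite ge0_integralZr//.
- by meas.
- by move=> x _; rewrite lee_fin.
- by apply: integral_ge0 => x _; rewrite lee_fin.
Qed.

End HalfPlane.

Section Intervals.
Context {R : realType}.
Local Notation mu := (@lebesgue_measure R).

Lemma ge0_integral_itv_split (a b c : R) (h : R -> \bar R) :
  measurable_fun setT h -> (forall x, 0 <= h x) -> (a <= b)%R -> (b <= c)%R ->
  \int[mu]_(s in `[a, c]) h s =
  \int[mu]_(s in `[a, b]) h s + \int[mu]_(s in `[b, c]) h s.
Proof.
move=> mh h0 ab bc.
have -> : `[a, c]%classic = `[a, b]%classic `|` `]b, c]%classic :> set R.
  by apply/esym; rewrite -itv_bndbnd_setU// bnd_simp.
rewrite ge0_integral_setU//.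
- by congr (_ + _); rewrite integral_itv_obnd_cbnd//; exact: measurable_funTS.
- exact: measurable_funTS.
- apply/disj_setPS => x []/=; rewrite !in_itv/= => /andP[_ xb] /andP[bx _].
  by have := lt_le_trans bx xb; rewrite ltxx.
Qed.

Lemma ge0_le_integral_itv (a b : R) (D : set R) (h : R -> \bar R) :
  measurable_fun setT h -> (forall x, 0 <= h x) -> measurable D ->
  `[a, b]%classic `<=` D -> \int[mu]_(s in `[a, b]) h s <= \int[mu]_(s in D) h s.
Proof.
by move=> mh h0 mD aD; apply: ge0_subset_integral => //; exact: measurable_funTS.
Qed.

Lemma integral_itv_cst (a b k : R) : (a <= b)%R ->
  \int[mu]_(s in `[a, b]) (k%:E) = (k * (b - a))%:E :> \bar R.
Proof.
move=> ab; rewrite integral_cst//= lebesgue_measure_itv/= lte_fin.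
case: ltP ab => [_ _|ba ab]; first by rewrite -EFinB -EFinM.
have -> : b = a by apply/eqP; rewrite eq_le ba ab.
by rewrite subrr mulr0 mule0.
Qed.

End Intervals.

Section Damping.
Context {R : realType}.
Local Notation mu := (@lebesgue_measure R).
Variables (c C : R) (m : R -> R).
Hypotheses (c0 : (0 <= c)%R) (C0 : (0 <= C)%R) (mm : measurable_fun setT m).
Hypotheses (m0 : forall t, (0 <= m t)%R) (mC : forall t, (m t <= C)%R).

Definition action (s t : R) : R := \int[mu]_(r in `[s, t]) m r.

Lemma action_le_itv (s t : R) : (s <= t)%R ->
  \int[mu]_(r in `[s, t]) (m r)%:E <= (C * (t - s))%:E.
Proof.
move=> st; rewrite -integral_itv_cst//; apply: ge0_le_integral => //.
- by move=> x _; rewrite lee_fin.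
- by apply: measurable_funTS; meas.
- by move=> x _; rewrite lee_fin.
Qed.

Lemma actionE (s t : R) : (action s t)%:E = \int[mu]_(r in `[s, t]) (m r)%:E.
Proof.
rewrite /action /Rintegral fineK// ge0_fin_numE; last first.
  by apply: integral_ge0 => r _; rewrite lee_fin.
have [st|ts] := leP s t.
  by apply: (le_lt_trans (action_le_itv st)); rewrite ltry.
by rewrite set_itv_ge ?integral_set0// bnd_simp -ltNge.
Qed.

Lemma action_ge0 s t : (0 <= action s t)%R.
Proof. by rewrite -lee_fin actionE integral_ge0// => r _; rewrite lee_fin. Qed.

Lemma action_le s t : (s <= t)%R -> (action s t <= C * (t - s))%R.
Proof. by move=> st; rewrite -lee_fin actionE action_le_itv. Qed.

Lemma action_split s t u : (s <= t)%R -> (t <= u)%R ->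
  action s u = (action s t + action t u)%R.
Proof.
move=> st tu; apply: EFin_inj; rewrite EFinD !actionE.
by apply: ge0_integral_itv_split => //; meas.
Qed.

Lemma measurable_action :
  measurable_fun setT (fun p : R * R => action p.1 p.2).
Proof.
rewrite /action /Rintegral; mstep.
by apply: measurable_pint_itv; meas; rewrite lee_fin.
Qed.

Let E s t := expR (- (c * action s t)).

(** Left-endpoint comparison on one cell: the integrand is at most
    [c * m u * E s p], and [expR (- x)] is [1 - x] up to an error [x ^+ 2]. *)
Let step s p q : (s <= p)%R -> (p <= q)%R ->
  \int[mu]_(u in `[p, q]) (c * m u * E s u)%:E <=
  (E s p - E s q + (c * C * (q - p)) ^+ 2)%:E.
Proof.
move=> sp pq; set x := (c * action p q)%R.
have x0 : (0 <= x)%R by rewrite mulr_ge0// action_ge0.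
have xC : (x <= c * C * (q - p))%R by rewrite -mulrA ler_wpM2l// action_le.
apply: (@le_trans _ _ (E s p * x)%:E).
  rewrite /x mulrA EFinM actionE -ge0_integralZ//; last 2 first.
  - by meas.
  - by rewrite mulr_ge0// expR_ge0.
  apply: ge0_le_integral => //.
  - by move=> u _; rewrite lee_fin !mulr_ge0// expR_ge0.
  - apply: measurable_funTS; rewrite /E; have ma := measurable_action; by meas.
  - by apply: measurable_funTS; meas.
  move=> u /=; rewrite in_itv/= => /andP[pu uq]; rewrite -EFinM lee_fin.
  apply: (@le_trans _ _ (c * m u * E s p)%R); last by rewrite mulrC mulrA.
  apply: ler_wpM2l; [exact: mulr_ge0|rewrite ler_expR lerN2].
  by rewrite ler_wpM2l// (action_split sp pu) lerDl action_ge0.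
have -> : E s q = (E s p * expR (- x))%R.
  by rewrite /E -expRD (action_split sp pq) mulrDr opprD.
have Esp1 : (E s p <= 1)%R.
  by rewrite /E expR_le1 oppr_le0 mulr_ge0// action_ge0.
have Esp0 : (0 <= E s p)%R by exact: expR_ge0.
(* from 1 + x <= expR x and (1 - x + x ^ 2) (1 + x) = 1 + x ^ 3 >= 1 *)
have ex : (expR (- x) <= 1 - x + x ^+ 2)%R.
  have x1 : (0 < 1 + x)%R by lra.
  have xe : (1 + x <= expR x)%R by exact: expR_ge1Dx.
  rewrite expRN (le_trans (_ : _ <= (1 + x)^-1)%R)//.
    by rewrite lef_pV2// posrE expR_gt0.
  rewrite -[leLHS]mul1r ler_pdivrMr//.
  have x3 : (0 <= x ^+ 3)%R by exact: exprn_ge0.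
  have -> : ((1 - x + x ^+ 2) * (1 + x) = 1 + x ^+ 3)%R by ring.
  lra.
rewrite lee_fin.
have : (x ^+ 2 <= (c * C * (q - p)) ^+ 2)%R by rewrite lerXn2r// nnegrE// (le_trans x0).
have : (E s p * expR (- x) <= E s p * (1 - x + x ^+ 2))%R by rewrite ler_wpM2l.
have : (E s p * x ^+ 2 <= x ^+ 2)%R by rewrite ler_piMl// exprn_ge0.
rewrite mulrDr mulrBr mulr1; set z := (_ ^+ 2)%R; set y := expR _.
lra.
Qed.

(** The integrand is minus the derivative of [expR (- (c * action s u))] in [u]
    when [m] is continuous.  For merely measurable [m] the chain rule is
    replaced by a telescoping sum over a partition into equal intervals, with
    an error that is quadratic in the mesh. *)
Lemma int_loss_le s t : (s <= t)%R ->
  \int[mu]_(u in `[s, t]) (c * m u * expR (- (c * action s u)))%:E <=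
  (1 - expR (- (c * action s t)))%:E.
Proof.
move=> st; pose D := ((c * C * (t - s)) ^+ 2)%R.
have mK : measurable_fun setT (fun u => (c * m u * E s u)%:E).
  by rewrite /E; have ma := measurable_action; meas.
have K0 u : 0 <= (c * m u * E s u)%:E.
  by rewrite lee_fin !mulr_ge0// expR_ge0.
suff H (n : nat) : \int[mu]_(u in `[s, t]) (c * m u * E s u)%:E <=
    (1 - E s t + D / n.+1%:R)%:E.
  apply/lee_addgt0Pr => e e0.
  have [n Dn] : exists n : nat, (D / n.+1%:R <= e)%R.
    exists (Num.truncn (D / e)); rewrite ler_pdivrMr// mulrC -ler_pdivrMr//.
    by apply: ltW; apply: truncnS_gt.
  by apply: (le_trans (H n)); rewrite -EFinD lee_fin lerD2l.
pose d := ((t - s) / n.+1%:R)%R.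
have d0 : (0 <= d)%R by rewrite divr_ge0// subr_ge0.
suff G (k : nat) : \int[mu]_(u in `[s, (s + k%:R * d)%R]) (c * m u * E s u)%:E <=
    (1 - E s (s + k%:R * d) + k%:R * (c * C * d) ^+ 2)%:E.
  have := G n.+1; have -> : (s + n.+1%:R * d = t)%R.
    by rewrite /d; field.
  congr (_ <= (_ + _)%:E); by rewrite /d /D; field.
elim: k => [|k IH].
  rewrite mul0r addr0 mul0r addr0 set_itv1 integral_set1 lee_fin subr_ge0.
  by rewrite expR_le1 oppr_le0 mulr_ge0// action_ge0.
have kd : (s <= s + k%:R * d)%R by rewrite lerDl mulr_ge0.
have kk : (s + k%:R * d <= s + k.+1%:R * d)%R.
  by rewrite lerD2l ler_wpM2r// ler_nat.
rewrite (ge0_integral_itv_split _ _ kd kk)//.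
apply: (le_trans (leeD IH (step kd kk))).
rewrite -EFinD lee_fin -[k.+1]addn1 natrD.
have -> : (s + (k%:R + 1) * d - (s + k%:R * d) = d)%R by ring.
have arith (x y k' z : R) :
  (1 - x + k' * z + (x - y + z) <= 1 - y + (k' + 1) * z)%R by lra.
exact: arith.
Qed.

End Damping.

(** * The mild equation for the density *)

Section Masses.
Context {R : realType}.
Local Notation mu := (@lebesgue_measure R).
Local Notation jmeas f := (measurable_fun setT (fun p : R * R => f p.1 p.2)).

Definition density (f : R -> R -> R) : Prop :=
  [/\ jmeas f, forall t x, (0 <= f t x)%R &
      forall t, \int[mu]_x (f t x)%:E < +oo].

Definition bounded_density (C : R) (f : R -> R -> R) : Prop :=
  [/\ jmeas f, forall t x, (0 <= f t x)%R &
      forall t, \int[mu]_x (f t x)%:E <= C%:E].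

Lemma bounded_density_density C f : bounded_density C f -> density f.
Proof.
by move=> [mf f0 fC]; split => // t; rewrite (le_lt_trans (fC t))// ltry.
Qed.
Coercion bounded_density_density : bounded_density >-> density.

Section finite_mass.
Variable f : R -> R -> R.
Hypothesis fd : density f.

Lemma massE t : (mass f t)%:E = \int[mu]_x (f t x)%:E.
Proof.
case: fd => mf f0 foo; rewrite /mass /Rintegral fineK// ge0_fin_numE//.
by apply: integral_ge0 => x _; rewrite lee_fin.
Qed.

Lemma mass_ge0 t : (0 <= mass f t)%R.
Proof.
by case: fd => _ f0 _; rewrite -lee_fin massE integral_ge0// => x _; rewrite lee_fin.
Qed.

Lemma measurable_mass : measurable_fun setT (mass f).
Proof.
case: fd => mf f0 _; rewrite /mass /Rintegral.
by apply: measurableT_comp => //; apply: measurable_pint; meas; rewrite lee_fin.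
Qed.

End finite_mass.

Variables (C : R) (f : R -> R -> R).
Hypothesis fC : bounded_density C f.

Lemma mass_le t : (mass f t <= C)%R.
Proof. by case: (fC) => _ _ fle; rewrite -lee_fin (massE fC). Qed.

Lemma bound_ge0 : (0 <= C)%R.
Proof. exact: le_trans (mass_ge0 fC 0) (mass_le 0). Qed.

Variable lambda : R.
Hypothesis l0 : (0 < lambda)%R.

Lemma dampingE s t :
  damping lambda f s t = expR (- (2 * lambda * action (mass f) s t)).
Proof. by rewrite /damping /action; congr expR; ring. Qed.

Lemma action_mass_ge0 s t : (0 <= 2 * lambda * action (mass f) s t)%R.
Proof.
rewrite !mulr_ge0 ?(ltW l0)// (@action_ge0 _ C)//.
- exact: (measurable_mass fC).
- exact: (mass_ge0 fC).
- exact: mass_le.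
Qed.

Lemma damping_le1 s t : (damping lambda f s t <= 1)%R.
Proof. by rewrite dampingE expR_le1 oppr_le0 action_mass_ge0. Qed.

Lemma measurable_damping :
  measurable_fun setT (fun p : R * R => damping lambda f p.1 p.2).
Proof.
rewrite [X in measurable_fun _ X](_ : _ =
  fun p => expR (- (2 * lambda * action (mass f) p.1 p.2))); last first.
  by apply/funext => p; rewrite dampingE.
have ma : measurable_fun setT (fun p : R * R => action (mass f) p.1 p.2).
  by apply: measurable_action; [exact: (measurable_mass fC)|exact: (mass_ge0 fC)].
by meas.
Qed.

End Masses.

(** In [[0, +oo]] a Lipschitz estimate is best written as two one-sided bounds
    [x <= y + z] and [y <= x + z], which need no finiteness; this lemma turns
    them into a bound on real differences. *)
Lemma fine_dist_le (R : realType) (x y z : \bar R) : 0 <= x -> 0 <= y -> 0 <= z ->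
  x <= y + z -> y <= x + z -> (`|fine x - fine y|%R)%:E <= z.
Proof.
move: x y z => [x| |] [y| |] [z| |]//=; rewrite ?subr0 ?normr0 ?leey//.
by rewrite -!EFinD !lee_fin ler_norml => _ _ _ xy yx; lra.
Qed.

(** The exponential has slope at most 1 on the nonpositive half line. *)
Lemma expRN_le (R : realType) (a b y : R) : (0 <= a)%R -> (0 <= y)%R ->
  (b <= a + y)%R -> (expR (- a) <= expR (- b) + y)%R.
Proof.
move=> a0 y0 bay.
have h1 : (expR (- a) * expR (- y) <= expR (- b))%R.
  by rewrite -expRD ler_expR; lra.
have h2 : (1 - y <= expR (- y))%R by exact: expR_ge1Dx.
have h3 : (expR (- a) <= 1)%R by rewrite expR_le1 oppr_le0.
have h4 : (expR (- a) * (1 - y) <= expR (- a) * expR (- y))%R.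
  by rewrite ler_wpM2l// expR_ge0.
have h5 : (expR (- a) * y <= y)%R by rewrite ler_piMl.
by rewrite mulrBr mulr1 in h4; lra.
Qed.

(** Representatives that are nonnegative everywhere.  The mass of [g0] is an
    iterated integral because pairs are always counted by Tonelli. *)
Record initial_data {R : realType} (lambda : R) (f0 : R -> R)
    (g0 : R * R -> R) (M0 N0 : R) : Prop := InitialData {
  coupling_gt0 : (0 < lambda)%R;
  measurable_f0 : measurable_fun setT f0;
  f0_nonneg : forall x, (0 <= f0 x)%R;
  f0_bound : \int[@lebesgue_measure R]_x (f0 x)%:E <= M0%:E;
  measurable_g0 : measurable_fun setT g0;
  g0_nonneg : forall p, (0 <= g0 p)%R;
  g0_bound : \int[@lebesgue_measure R]_y \int[@lebesgue_measure R]_x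
               (g0 (x, y))%:E <= N0%:E }.

Section MildOperator.
Context {R : realType}.
Local Notation mu := (@lebesgue_measure R).
Local Notation jmeas f := (measurable_fun setT (fun p : R * R => f p.1 p.2)).
Variables (lambda : R) (f0 : R -> R) (g0 : R * R -> R) (M0 N0 : R).
Hypothesis data : initial_data lambda f0 g0 M0 N0.
Let l0 : (0 < lambda)%R. Proof. exact: coupling_gt0 data. Qed.
Let mf0 : measurable_fun setT f0. Proof. exact: measurable_f0 data. Qed.
Let f0_ge0 : forall x, (0 <= f0 x)%R. Proof. exact: f0_nonneg data. Qed.
Let f0M : \int[mu]_x (f0 x)%:E <= M0%:E. Proof. exact: f0_bound data. Qed.
Let mg0 : measurable_fun setT g0. Proof. exact: measurable_g0 data. Qed.
Let g0_ge0 : forall p, (0 <= g0 p)%R. Proof. exact: g0_nonneg data. Qed.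
Let g0N : \int[mu]_y \int[mu]_x (g0 (x, y))%:E <= N0%:E.
Proof. exact: g0_bound data. Qed.

(** Pairs that meet at [x] at time [s]: those present initially, and those
    created by encounters of two particles. *)
Definition source (f : R -> R -> R) (s x : R) : \bar R :=
  4%:E * (g0 (x + s / 2, x - s / 2))%:E +
  (4 * lambda)%:E * collision f f s x.

Definition mild (f : R -> R -> R) (t x : R) : \bar R :=
  (damping lambda f 0 t * f0 x)%:E +
  \int[mu]_(s in `[0%R, t]) ((damping lambda f s t)%:E * source f s x).

Let l4 : (0 <= 4 * lambda)%R. Proof. by rewrite mulr_ge0// ltW. Qed.

Section one_density.
Variables (C : R) (f : R -> R -> R).
Hypothesis fC : bounded_density C f.
Let mf : jmeas f. Proof. by case: fC. Qed.
Let f_ge0 : forall t x, (0 <= f t x)%R. Proof. by case: fC. Qed.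
Let fle : forall t, \int[mu]_x (f t x)%:E <= C%:E. Proof. by case: fC. Qed.

Lemma source_ge0 s x : 0 <= source f s x.
Proof.
rewrite adde_ge0// mule_ge0 ?lee_fin//.
exact: collision_ge0.
Qed.

Lemma measurable_source : measurable_fun setT (fun p : R * R => source f p.1 p.2).
Proof.
rewrite /source; have mc := measurable_collision mf mf f_ge0 f_ge0.
by meas.
Qed.

Lemma mild_ge0 t x : 0 <= mild f t x.
Proof.
rewrite adde_ge0//; first by rewrite lee_fin mulr_ge0// expR_ge0.
by apply: integral_ge0 => s _; rewrite mule_ge0 ?source_ge0// lee_fin expR_ge0.
Qed.

Lemma measurable_mild : measurable_fun setT (fun p : R * R => mild f p.1 p.2).
Proof.
have md := measurable_damping fC lambda; have ms := measurable_source.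
rewrite /mild; mstep; first by meas.
apply: measurable_pint_itv; [by meas|by meas|by meas|].
by move=> p s; rewrite mule_ge0 ?source_ge0// lee_fin expR_ge0.
Qed.

(** An initial pair is counted at the single time equal to its gap, so the total
    over meeting times cannot exceed the mass of [g0]. *)
Lemma int_g0_le t :
  \int[mu]_(s in `[0%R, t]) \int[mu]_x (g0 (x + s / 2, x - s / 2))%:E <= N0%:E.
Proof.
have g0E s : \int[mu]_x (g0 (x + s / 2, x - s / 2))%:E =
    \int[mu]_y (g0 (s + y, y))%:E.
  rewrite -(@integral_translation _ (- (s / 2)) (fun y => (g0 (s + y, y))%:E))//.
  - by apply: eq_integral => x _; congr (g0 (_, _))%:E; field.
  - by meas.
  - by move=> y; rewrite lee_fin.
under eq_integral do rewrite g0E.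
pose k (s y : R) : \bar R := (g0 (s + y, y))%:E.
have mk : jmeas k by rewrite /k; meas.
have k0 s y : 0 <= k s y by rewrite lee_fin.
rewrite -(tonelli_itv 0 t mk k0).
apply: (le_trans _ g0N); apply: ge0_le_integral => //.
- by move=> y _; apply: integral_ge0 => s _; rewrite lee_fin.
- by apply: measurable_pint_itv; meas; rewrite lee_fin.
- by apply: measurable_pint; meas; rewrite lee_fin.
move=> y _.
rewrite -(@integral_translation _ y (fun x => (g0 (x, y))%:E))//; first last.
- by move=> x; rewrite lee_fin.
- by meas.
by apply: ge0_subset_integral => //; meas.
Qed.

Lemma int_sourceE t :
  \int[mu]_(s in `[0%R, t]) \int[mu]_x source f s x =
  4%:E * \int[mu]_(s in `[0%R, t]) \int[mu]_x (g0 (x + s / 2, x - s / 2))%:E +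
  (4 * lambda)%:E * \int[mu]_(s in `[0%R, t]) \int[mu]_x collision f f s x.
Proof.
have mc := measurable_collision mf mf f_ge0 f_ge0.
have c0 := collision_ge0 f_ge0 f_ge0.
have g1 s x : 0 <= (g0 (x + s / 2, x - s / 2))%:E by rewrite lee_fin.
have mG : measurable_fun setT (fun s : R => \int[mu]_x (g0 (x + s / 2, x - s / 2))%:E).
  by apply: measurable_pint => //; meas.
have mI : measurable_fun setT (fun s : R => \int[mu]_x collision f f s x).
  by apply: measurable_pint => //; meas.
have G0 s : 0 <= \int[mu]_x (g0 (x + s / 2, x - s / 2))%:E by exact: integral_ge0.
have I0 s : 0 <= \int[mu]_x collision f f s x by exact: integral_ge0.
rewrite -!ge0_integralZ// -ge0_integralD//; first last.
- by apply: measurable_funTS; meas.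
- by move=> s _; rewrite mule_ge0.
- by apply: measurable_funTS; meas.
- by move=> s _; rewrite mule_ge0.
apply: eq_integral => s _; rewrite /source ge0_integralD//; first last.
- by meas.
- by move=> x _; rewrite mule_ge0.
- by meas.
- by move=> x _; rewrite mule_ge0.
by rewrite !ge0_integralZ//; meas.
Qed.

Lemma int_source_le t T : (0 <= T)%R -> (t <= T)%R ->
  \int[mu]_(s in `[0%R, t]) \int[mu]_x source f s x <=
  (4 * N0 + 4 * lambda * (C ^+ 2 * T))%:E.
Proof.
move=> T0 tT; rewrite int_sourceE [leRHS]EFinD; apply: leeD.
  by rewrite [leRHS]EFinM; apply: lee_wpmul2l; [rewrite lee_fin|exact: int_g0_le].
rewrite [leRHS]EFinM; apply: lee_wpmul2l; first by rewrite lee_fin.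
apply: le_trans (int_collision_le _ _ _ _ _) _ => //.
have C0 := bound_ge0 fC.
have mm := measurable_mass fC.
apply: (@le_trans _ _ (\int[mu]_(s in `[0%R, T]) (C ^+ 2)%:E)).
  apply: (@le_trans _ _ (\int[mu]_(s in `[0%R, t]) (C ^+ 2)%:E)).
    apply: ge0_le_integral => //.
    - by move=> r _; rewrite -(massE fC) mule_ge0// lee_fin (mass_ge0 fC).
    - rewrite [X in measurable_fun _ X](_ : _ =
        fun r => (mass f r)%:E * (mass f r)%:E); last first.
        by apply/funext => r; rewrite (massE fC).
      by apply: measurable_funTS; meas.
    move=> r _; rewrite -(massE fC) -EFinM lee_fin expr2.
    by apply: ler_pM; rewrite ?(mass_ge0 fC) ?(mass_le fC).
  apply: ge0_subset_integral => //.
  - by move=> ? _; rewrite lee_fin exprn_ge0.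
  - by apply: subset_itvl; rewrite bnd_simp.
by rewrite integral_itv_cst// subr0.
Qed.

Lemma int_mildE t : \int[mu]_x mild f t x =
  (damping lambda f 0 t)%:E * \int[mu]_x (f0 x)%:E +
  \int[mu]_(s in `[0%R, t]) ((damping lambda f s t)%:E * \int[mu]_x source f s x).
Proof.
have md := measurable_damping fC lambda; have ms := measurable_source.
have k0 x s : 0 <= (damping lambda f s t)%:E * source f s x.
  by rewrite mule_ge0 ?source_ge0// lee_fin expR_ge0.
rewrite /mild ge0_integralD//; first last.
- by apply: measurable_pint_itv => //; meas.
- by move=> x _; exact: integral_ge0.
- by meas.
- by move=> x _; rewrite lee_fin mulr_ge0// expR_ge0.
congr (_ + _).
  by under eq_integral do rewrite EFinM; rewrite ge0_integralZ ?expR_ge0//; meas.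
pose k s x := (damping lambda f s t)%:E * source f s x.
have mk : measurable_fun setT (fun p : R * R => k p.1 p.2) by rewrite /k; meas.
rewrite (tonelli_itv 0 t mk (fun s x => k0 x s)).
apply: eq_integral => s _; rewrite ge0_integralZ ?expR_ge0//; first by meas.
by move=> x; exact: source_ge0.
Qed.

Lemma int_mild_le t T : (0 <= T)%R -> (t <= T)%R ->
  \int[mu]_x mild f t x <= (M0 + (4 * N0 + 4 * lambda * (C ^+ 2 * T)))%:E.
Proof.
move=> T0 tT; have md := measurable_damping fC lambda; have ms := measurable_source.
have I0 s : 0 <= \int[mu]_x source f s x.
  by apply: integral_ge0 => x _; exact: source_ge0.
have mI : measurable_fun setT (fun s : R => \int[mu]_x source f s x).
  by apply: measurable_pint => //; exact: source_ge0.
rewrite int_mildE [leRHS]EFinD; apply: leeD.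
  apply: le_trans f0M; rewrite -[leRHS]mul1e lee_wpmul2r//.
    by apply: integral_ge0 => x _; rewrite lee_fin.
  by rewrite lee_fin (damping_le1 fC).
apply: le_trans _ (int_source_le T0 tT).
apply: ge0_le_integral; first exact: measurable_itv.
- by move=> s _; rewrite mule_ge0// lee_fin expR_ge0.
- by apply: measurable_funTS; meas.
- exact: measurable_funTS.
move=> s _; rewrite -[leRHS]mul1e lee_wpmul2r//.
by rewrite lee_fin (damping_le1 fC).
Qed.

End one_density.
End MildOperator.

(** * Lipschitz dependence on the density *)

(** Abstract forms of the two products that enter [mild_lip_pointwise], with
    atomic arguments in place of large integrals. *)
Lemma lee_damped_datum (R : realType) (a b c : R) (D : \bar R) :
  (0 <= b)%R -> (0 <= c)%R -> 0 <= D -> a%:E <= b%:E + D ->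
  (a * c)%:E <= (b * c)%:E + D * c%:E.
Proof.
move=> b0 c0 D0 abD; rewrite !EFinM -ge0_muleDl ?lee_fin//.
by apply: lee_wpmul2r; rewrite ?lee_fin.
Qed.

Lemma lee_damped_source (R : realType) (a b : R) (D S S' B : \bar R) :
  (0 <= a)%R -> (a <= 1)%R -> (0 <= b)%R -> 0 <= D -> 0 <= S' -> 0 <= B ->
  a%:E <= b%:E + D -> S <= S' + B ->
  a%:E * S <= b%:E * S' + (D * S' + B).
Proof.
move=> a0 a1 b0 D0 S0 B0 abD SS.
apply: (@le_trans _ _ (a%:E * (S' + B))).
  by apply: lee_wpmul2l; rewrite ?lee_fin.
rewrite ge0_muleDr// addeA; apply: leeD.
  by rewrite -ge0_muleDl ?lee_fin//; apply: lee_wpmul2r.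
by rewrite -[leRHS]mul1e; apply: lee_wpmul2r; rewrite ?lee_fin.
Qed.

Section Lipschitz.
Context {R : realType}.
Local Notation mu := (@lebesgue_measure R).
Local Notation jmeas f := (measurable_fun setT (fun p : R * R => f p.1 p.2)).

Definition dist1 (f g : R -> R -> R) (t : R) : \bar R :=
  \int[mu]_x (`|f t x - g t x|%R)%:E.

Lemma dist1_ge0 f g t : 0 <= dist1 f g t.
Proof. by apply: integral_ge0 => x _; rewrite lee_fin. Qed.

Lemma dist1C f g t : dist1 f g t = dist1 g f t.
Proof. by apply: eq_integral => x _; rewrite distrC. Qed.

Lemma measurable_dist1 f g : jmeas f -> jmeas g ->
  measurable_fun setT (dist1 f g).
Proof. by move=> mf mg; apply: measurable_pint; meas; rewrite lee_fin. Qed.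

Lemma mass_le_dist f g t : density f -> density g ->
  (mass g t)%:E <= (mass f t)%:E + dist1 f g t.
Proof.
move=> fC gC; case: (fC) (gC) => mf f0 _ [mg g0 _].
rewrite (massE fC) (massE gC) /dist1 -ge0_integralD//; first last.
- by meas.
- by meas.
- by move=> x _; rewrite lee_fin.
apply: ge0_le_integral => //.
- by move=> x _; rewrite lee_fin.
- by meas.
- by meas.
move=> x _; rewrite -EFinD lee_fin.
by have := ler_norm (g t x - f t x); rewrite distrC; lra.
Qed.

(** Damping factors are exponentials of actions, and the action integrates the
    mass, which is 1-Lipschitz for the [L^1] distance. *)
Lemma damping_lip lambda C f g s t : (0 < lambda)%R -> (0 <= s)%R ->
  bounded_density C f -> bounded_density C g ->
  (damping lambda f s t)%:E <= (damping lambda g s t)%:E +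
    (2 * lambda)%:E * \int[mu]_(r in `[0%R, t]) dist1 f g r.
Proof.
move=> l0 s0 fC gC; case: (fC) (gC) => mf _ _ [mg _ _].
have mD := measurable_dist1 mf mg.
have D0 := @dist1_ge0 f g.
have mmf := measurable_mass fC; have mmg := measurable_mass gC.
have act : (action (mass g) s t)%:E <= (action (mass f) s t)%:E +
    \int[mu]_(r in `[0%R, t]) dist1 f g r.
  rewrite (actionE mmf (mass_ge0 fC) (mass_le fC)).
  rewrite (actionE mmg (mass_ge0 gC) (mass_le gC)).
  apply: (@le_trans _ _ (\int[mu]_(r in `[s, t]) (mass f r)%:E +
      \int[mu]_(r in `[s, t]) dist1 f g r)).
    rewrite -ge0_integralD//; first last.
    - exact: measurable_funTS.
    - by apply: measurable_funTS; meas.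
    - by move=> r _; rewrite lee_fin (mass_ge0 fC).
    apply: ge0_le_integral => //.
    - by move=> r _; rewrite lee_fin (mass_ge0 gC).
    - by apply: measurable_funTS; meas.
    - by apply: measurable_funTS; meas.
    - by move=> r _; exact: (mass_le_dist _ fC gC).
  apply: leeD => //; apply: ge0_le_integral_itv => //.
  by apply: subset_itvr; rewrite bnd_simp.
rewrite !dampingE.
have I0 : 0 <= \int[mu]_(r in `[0%R, t]) dist1 f g r by exact: integral_ge0.
move: I0 act; case: (\int[mu]_(r in _) _) => [x| |]//; last first.
  by move=> _ _; rewrite gt0_muley ?addey ?leey// lte_fin mulr_gt0.
rewrite -EFinD -EFinM -EFinD !lee_fin => x0 act.
apply: expRN_le.
- exact: (action_mass_ge0 fC l0 s t).
- by rewrite !mulr_ge0// ltW.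
- by rewrite -mulrDr ler_wpM2l// mulr_ge0// ltW.
Qed.

(** Bilinearity: [a b - c d = (a - c) b + c (b - d)]. *)
Lemma collision_lip (C : R) (f g : R -> R -> R) (s x : R) :
  bounded_density C f -> bounded_density C g ->
  collision f f s x <= collision g g s x +
    (collision (fun r y : R => `|f r y - g r y|%R) f s x +
     collision g (fun r y : R => `|f r y - g r y|%R) s x).
Proof.
case=> mf f0 _ [mg g0 _]; rewrite /collision.
pose w r y := `|f r y - g r y|%R.
have w0 r y : (0 <= w r y)%R by rewrite /w.
have mw : jmeas w by rewrite /w; meas.
have MM (u v : R -> R -> R) : jmeas u -> jmeas v -> measurable_fun `[0%R, s]
    (fun r => (u r (x + (s - r) / 2) * v r (x - (s - r) / 2))%:E).
  by move=> mu_ mv; apply: measurable_funTS; meas.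
have PP (u v : R -> R -> R) r : (forall t x, (0 <= u t x)%R) ->
    (forall t x, (0 <= v t x)%R) ->
    0 <= (u r (x + (s - r) / 2) * v r (x - (s - r) / 2))%:E.
  by move=> u0 v0; rewrite lee_fin mulr_ge0.
have Mwf := MM _ _ mw mf; have Mgw := MM _ _ mg mw.
have Mff := MM _ _ mf mf; have Mgg := MM _ _ mg mg.
have Pwf r := PP w f r w0 f0; have Pgw r := PP g w r g0 w0.
have Pff r := PP f f r f0 f0; have Pgg r := PP g g r g0 g0.
rewrite -(@ge0_integralD _ _ _ mu _ _ (fun r =>
    (w r (x + (s - r) / 2) * f r (x - (s - r) / 2))%:E))//.
rewrite -ge0_integralD//; first last.
- exact: emeasurable_funD.
- by move=> r _; exact: adde_ge0.
apply: ge0_le_integral => //.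
  by do 2?apply: emeasurable_funD.
move=> r _; rewrite -!EFinD lee_fin /w.
set a := f r _; set b := f r _; set c := g r _; set d := g r _.
have h1 : (a * b = c * d + ((a - c) * b + c * (b - d)))%R by ring.
rewrite h1 lerD2l; apply: lerD.
- by rewrite ler_wpM2r// ?f0// ler_norm.
- by rewrite ler_wpM2l// ?g0// ler_norm.
Qed.

Variables (lambda : R) (f0 : R -> R) (g0 : R * R -> R) (M0 N0 : R).
Hypothesis data : initial_data lambda f0 g0 M0 N0.
Let l0 : (0 < lambda)%R. Proof. exact: coupling_gt0 data. Qed.
Let mf0 : measurable_fun setT f0. Proof. exact: measurable_f0 data. Qed.
Let f0_ge0 : forall x, (0 <= f0 x)%R. Proof. exact: f0_nonneg data. Qed.
Let f0M : \int[mu]_x (f0 x)%:E <= M0%:E. Proof. exact: f0_bound data. Qed.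

Section two_densities.
Variables (C : R) (f g : R -> R -> R).
Hypotheses (fC : bounded_density C f) (gC : bounded_density C g).
Let mf : jmeas f. Proof. by case: fC. Qed.
Let mg : jmeas g. Proof. by case: gC. Qed.
Let f_ge0 : forall t x, (0 <= f t x)%R. Proof. by case: fC. Qed.
Let g_ge0 : forall t x, (0 <= g t x)%R. Proof. by case: gC. Qed.

Let w r y := (`|f r y - g r y|)%R.
Let mw : jmeas w. Proof. by rewrite /w; meas. Qed.
Let w_ge0 : forall t x, (0 <= w t x)%R. Proof. by move=> t x; rewrite /w. Qed.
Let B s x := (4 * lambda)%:E * (collision w f s x + collision g w s x).
Let Dl t := (2 * lambda)%:E * \int[mu]_(r in `[0%R, t]) dist1 f g r.

(** Pointwise majorant of the difference of two right-hand sides: the change of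
    the damping factors acts on the data and on the source, and [B] is the
    change of the source. *)
Definition mild_gap (t x : R) : \bar R :=
  Dl t * (f0 x)%:E +
  \int[mu]_(s in `[0%R, t]) (Dl t * source lambda g0 g s x + B s x).

Let l4 : (0 <= 4 * lambda)%R. Proof. by rewrite mulr_ge0// ltW. Qed.
Let B0 s x : 0 <= B s x.
Proof. by rewrite mule_ge0// adde_ge0// collision_ge0. Qed.
Let Dl0 t : 0 <= Dl t.
Proof.
by rewrite mule_ge0// ?lee_fin ?mulr_ge0 ?(ltW l0)// integral_ge0// => r _; exact: dist1_ge0.
Qed.
Let S0 s x : 0 <= source lambda g0 g s x. Proof. exact: (source_ge0 data gC s x). Qed.
Let mB : measurable_fun setT (fun p : R * R => B p.1 p.2).
Proof.
have m1 := measurable_collision mw mf w_ge0 f_ge0.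
have m2 := measurable_collision mg mw g_ge0 w_ge0.
by rewrite /B; meas.
Qed.
Let mS : measurable_fun setT (fun p : R * R => source lambda g0 g p.1 p.2).
Proof. exact: (measurable_source data gC). Qed.

Lemma mild_gap_ge0 t x : 0 <= mild_gap t x.
Proof.
rewrite adde_ge0//; first by rewrite mule_ge0 ?lee_fin.
by apply: integral_ge0 => s _; rewrite adde_ge0// mule_ge0.
Qed.

Lemma measurable_mild_gap t : measurable_fun setT (mild_gap t).
Proof.
rewrite /mild_gap; mstep; first by meas.
apply: measurable_pint_itv; [by meas|by meas|by meas|].
by move=> x s; rewrite adde_ge0// mule_ge0.
Qed.

Lemma source_lip s x : source lambda g0 f s x <= source lambda g0 g s x + B s x.
Proof.
rewrite /source /B -addeA leeD2l// -ge0_muleDr; last 2 first.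
- exact: collision_ge0.
- by rewrite adde_ge0// collision_ge0.
by apply: lee_wpmul2l => //; exact: (collision_lip _ _ fC gC).
Qed.

Lemma mild_lip_pointwise t x :
  mild lambda f0 g0 f t x <= mild lambda f0 g0 g t x + mild_gap t x.
Proof.
have mdf := measurable_damping fC lambda; have mdg := measurable_damping gC lambda.
have mSf := measurable_source data fC; have Sf0 := source_ge0 data fC.
have dl s : (0 <= s)%R -> (damping lambda f s t)%:E <= (damping lambda g s t)%:E + Dl t.
  by move=> s0; exact: (damping_lip _ l0 s0 fC gC).
rewrite /mild /mild_gap addeACA; apply: leeD.
  by apply: lee_damped_datum; [exact: expR_ge0|exact: f0_ge0|exact: Dl0|exact: dl].
rewrite -ge0_integralD//; first last.
- by apply: measurable_funTS; meas.
- by move=> s _; rewrite adde_ge0// mule_ge0.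
- by apply: measurable_funTS; meas.
- by move=> s _; rewrite mule_ge0// lee_fin expR_ge0.
apply: ge0_le_integral; first exact: measurable_itv.
- by move=> s _; rewrite mule_ge0// lee_fin expR_ge0.
- by apply: measurable_funTS; meas.
- by apply: measurable_funTS; meas.
move=> s /=; rewrite in_itv/= => /andP[s0 st].
apply: lee_damped_source; [exact: expR_ge0|exact: (damping_le1 fC l0)|
  exact: expR_ge0|exact: Dl0|exact: S0|exact: B0|exact: dl|exact: source_lip].
Qed.

(** The first summand is the total supply up to time [T] times the Lipschitz
    constant of the damping; the second comes from the two collision terms. *)
Definition lip_const (T : R) : R :=
  (2 * lambda * (M0 + (4 * N0 + 4 * lambda * (C ^+ 2 * T))) + 8 * lambda * C)%R.

Lemma lip_const_damping_ge0 T : (0 <= T)%R ->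
  (0 <= M0 + (4 * N0 + 4 * lambda * (C ^+ 2 * T)))%R.
Proof.
move=> T0.
have M00 : (0 <= M0)%R.
  by rewrite -lee_fin (le_trans _ f0M)// integral_ge0// => x _; rewrite lee_fin.
have N00 : (0 <= N0)%R.
  rewrite -lee_fin (le_trans _ (g0_bound data))// integral_ge0// => y _.
  by rewrite integral_ge0// => x _; rewrite lee_fin (g0_nonneg data).
have C0 := bound_ge0 fC.
by rewrite !addr_ge0 ?mulr_ge0 ?(ltW l0).
Qed.

Lemma lip_const_ge0 T : (0 <= T)%R -> (0 <= lip_const T)%R.
Proof.
move=> T0; have C0 := bound_ge0 fC; have Q0 := lip_const_damping_ge0 T0.
by rewrite addr_ge0 ?mulr_ge0 ?(ltW l0).
Qed.

Let int_collision_mass (u v : R -> R -> R) t : jmeas u -> jmeas v ->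
  (forall t x, (0 <= u t x)%R) -> (forall t x, (0 <= v t x)%R) ->
  (forall r, \int[mu]_x (u r x)%:E * \int[mu]_x (v r x)%:E <= C%:E * dist1 f g r) ->
  \int[mu]_(s in `[0%R, t]) \int[mu]_x collision u v s x <=
  C%:E * \int[mu]_(r in `[0%R, t]) dist1 f g r.
Proof.
move=> mu_ mv u0 v0 uv; have mD := measurable_dist1 mf mg.
apply: (le_trans (int_collision_le mu_ mv u0 v0 t)).
rewrite -ge0_integralZ//; [|by move=> r; exact: dist1_ge0|exact: (bound_ge0 fC)].
apply: ge0_le_integral; first exact: measurable_itv.
- by move=> r _; rewrite mule_ge0// integral_ge0// => x _; rewrite lee_fin.
- apply: measurable_funTS; apply: emeasurable_funM; apply: measurable_pint;
    by meas; rewrite lee_fin.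
- by apply: measurable_funTS; meas.
- by move=> r _; exact: uv.
Qed.

(** All terms of [mild_gap] are integrated by Tonelli; a collision with the
    difference of the densities costs the mass [C] of the other factor by
    [int_collision_le]. *)
Lemma int_mild_gap_le t T : (0 <= T)%R -> (t <= T)%R ->
  \int[mu]_x mild_gap t x <=
  (lip_const T)%:E * \int[mu]_(r in `[0%R, t]) dist1 f g r.
Proof.
move=> T0 tT; set I := \int[mu]_(r in `[0%R, t]) _.
have I0 : 0 <= I by apply: integral_ge0 => r _; exact: dist1_ge0.
have C0 := bound_ge0 fC.
have J0 s : 0 <= \int[mu]_x source lambda g0 g s x by exact: integral_ge0.
have K0 s : 0 <= \int[mu]_x B s x by exact: integral_ge0.
have m1 := measurable_collision mw mf w_ge0 f_ge0.
have m2 := measurable_collision mg mw g_ge0 w_ge0.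
have p1 := collision_ge0 w_ge0 f_ge0; have p2 := collision_ge0 g_ge0 w_ge0.
have intB : \int[mu]_(s in `[0%R, t]) \int[mu]_x B s x <= (8 * lambda * C)%:E * I.
  have m12 : jmeas (fun s x => collision w f s x + collision g w s x) by meas.
  have p12 s x : 0 <= collision w f s x + collision g w s x by exact: adde_ge0.
  have -> : \int[mu]_(s in `[0%R, t]) \int[mu]_x B s x = (4 * lambda)%:E *
    (\int[mu]_(s in `[0%R, t]) \int[mu]_x collision w f s x +
     \int[mu]_(s in `[0%R, t]) \int[mu]_x collision g w s x).
    have l4e : 0 <= (4 * lambda)%:E by rewrite lee_fin.
    apply: (eq_trans (int2Z t m12 p12 l4e)); congr (_ * _).
    exact: (int2D t m1 m2 p1 p2).
  have -> : (8 * lambda * C = 4 * lambda * (C + C))%R by ring.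
  rewrite [X in _ <= X * _]EFinM -muleA; apply: lee_wpmul2l => //.
  rewrite [X in _ <= X * _]EFinD ge0_muleDl ?lee_fin//; apply: leeD.
  - apply: int_collision_mass => // r; rewrite muleC; apply: lee_wpmul2r.
      exact: dist1_ge0.
    by case: fC.
  - apply: int_collision_mass => // r; apply: lee_wpmul2r.
      exact: dist1_ge0.
    by case: gC.
pose k s x := Dl t * source lambda g0 g s x + B s x.
have mDS : jmeas (fun s x => Dl t * source lambda g0 g s x) by meas.
have pDS s x : 0 <= Dl t * source lambda g0 g s x by exact: mule_ge0.
have mk : jmeas k by rewrite /k; meas.
have k0 s x : 0 <= k s x by exact: adde_ge0.
have -> : \int[mu]_x mild_gap t x = Dl t * \int[mu]_x (f0 x)%:E +
    \int[mu]_x \int[mu]_(s in `[0%R, t]) k s x.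
  rewrite /mild_gap ge0_integralD//; first last.
  - apply: measurable_pint_itv; [by meas|by meas|by meas|].
    by move=> x s; exact: k0.
  - by move=> x _; apply: integral_ge0 => s _; exact: k0.
  - by meas.
  - by move=> x _; rewrite mule_ge0 ?lee_fin.
  congr (_ + _); apply: ge0_integralZl => //; first by meas.
  by move=> x _; rewrite lee_fin.
rewrite (tonelli_itv 0 t mk k0).
have -> : \int[mu]_(s in `[0%R, t]) \int[mu]_x k s x =
  Dl t * (\int[mu]_(s in `[0%R, t]) \int[mu]_x source lambda g0 g s x) +
  \int[mu]_(s in `[0%R, t]) \int[mu]_x B s x.
  apply: (eq_trans (int2D t mDS mB pDS B0)); congr (_ + _).
  exact: (int2Z t mS S0 (Dl0 t)).
rewrite addeA -ge0_muleDr; last 2 first.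
- by apply: integral_ge0 => x _; rewrite lee_fin.
- by apply: integral_ge0 => s _; exact: J0.
have Q0 := lip_const_damping_ge0 T0.
rewrite /lip_const [X in _ <= X * _]EFinD ge0_muleDl; last 2 first.
- by rewrite lee_fin !mulr_ge0 ?(ltW l0).
- by rewrite lee_fin !mulr_ge0 ?(ltW l0).
apply: leeD => //.
rewrite [X in _ <= X * _]EFinM [leRHS]muleAC.
apply: lee_wpmul2l; first exact: Dl0.
rewrite [leRHS]EFinD; apply: leeD; first exact: f0M.
exact: (int_source_le data gC T0 tT).
Qed.

End two_densities.
End Lipschitz.

(** * Volterra inequalities *)

Section Gronwall.
Context {R : realType}.
Local Notation mu := (@lebesgue_measure R).

Lemma int_expR_le (k t : R) : (0 < k)%R -> (0 <= t)%R ->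
  \int[mu]_(s in `[0%R, t]) (expR (k * s))%:E <= (expR (k * t) / k)%:E.
Proof.
move=> k0; rewrite le_eqVlt => /predU1P[<-|t0].
  by rewrite set_itv1 integral_set1 lee_fin divr_ge0 ?expR_ge0 ?ltW.
pose F (s : R) : R := (expR (k * s) / k)%R.
have dF (s : R) : is_derive s (1%R : R) F (expR (k * s)).
  rewrite /F; apply: is_derive_eq.
  by rewrite scaler0 add0r /GRing.scale/= mulr1 mulrC mulfK// gt_eqF.
have cF : continuous F.
  by move=> s; apply/differentiable_continuous/derivable1_diffP; case: (dF s).
have cf : continuous (fun s : R => expR (k * s)).
  move=> s; apply: (@continuous_comp _ _ _ (fun s => k * s)%R expR).
    exact: mulrl_continuous.
  exact: continuous_expR.
rewrite (@continuous_FTC2 _ _ F)//; first last.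
- move=> s _; rewrite derive1E; exact: (@derive_val _ _ _ _ _ _ _ (dF s)).
- split.
  + by move=> s _; case: (dF s).
  + by apply: cvg_at_right_filter; exact: cF.
  + by apply: cvg_at_left_filter; exact: cF.
- exact: continuous_subspaceT.
by rewrite -EFinB lee_fin gerBl /F divr_ge0 ?expR_ge0// ltW.
Qed.

(** Weighting by [expR (2 * c * t)] turns the Volterra operator
    [u |-> c * int_0^t u] into a contraction with factor 1/2 on [[0, T]]; this
    serves both the Picard iteration and, with a constant sequence, uniqueness.
    The predicate [P] confines the hypotheses to a set of full measure, since a
    mild solution satisfies its equation at almost every time only. *)
Lemma volterra_decay (P : R -> Prop) (d : nat -> R -> \bar R) (A c T : R) :
  (0 <= A)%R -> (0 < c)%R ->
  (forall n, measurable_fun setT (d n)) -> (forall n t, 0 <= d n t) ->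
  {ae mu, forall t, P t} ->
  (forall t, P t -> (0 <= t <= T)%R -> d 0%N t <= A%:E) ->
  (forall n t, P t -> (0 <= t <= T)%R ->
     d n.+1 t <= c%:E * \int[mu]_(s in `[0%R, t]) d n s) ->
  forall n t, P t -> (0 <= t <= T)%R ->
    d n t <= (A / 2 ^+ n * expR (2 * c * t))%:E.
Proof.
move=> A0 c0 md d0 aeP dA dS; elim=> [|n IH] t Pt tT.
  apply: (le_trans (dA _ Pt tT)); case/andP: tT => t0 _.
  rewrite lee_fin expr0 divr1 ler_peMr// -expR0 ler_expR.
  by rewrite !mulr_ge0// ltW.
apply: (le_trans (dS _ _ Pt tT)); case/andP: tT => t0 tT.
have An0 : (0 <= A / 2 ^+ n)%R by rewrite divr_ge0// exprn_ge0.
apply: (@le_trans _ _ (c%:E * \int[mu]_(s in `[0%R, t])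
    ((A / 2 ^+ n)%:E * (expR (2 * c * s))%:E))).
  apply: lee_wpmul2l; first by rewrite lee_fin ltW.
  apply: ae_ge0_le_integral => //.
  - by apply: measurable_funTS; exact: md.
  - by move=> s _; rewrite mule_ge0// lee_fin expR_ge0.
  - by apply: measurable_funTS; meas.
  apply: ae_imply aeP => s Ps /=; rewrite in_itv/= => /andP[s0 st].
  by rewrite -EFinM; apply: IH => //; rewrite s0 (le_trans st).
rewrite ge0_integralZ//; last by meas.
have c2 : (0 < 2 * c)%R by rewrite mulr_gt0.
apply: (@le_trans _ _ (c%:E * ((A / 2 ^+ n)%:E * (expR (2 * c * t) / (2 * c))%:E))).
  apply: lee_wpmul2l; first by rewrite lee_fin ltW.
  by apply: lee_wpmul2l; [rewrite lee_fin|exact: int_expR_le].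
rewrite -!EFinM lee_fin exprS le_eqVlt; apply/orP; left; apply/eqP.
by field; rewrite expf_neq0//= gt_eqF.
Qed.

Lemma cvg_of_summable_increments (v : R^nat) :
  \sum_(k <oo) (`|v k.+1 - v k|%R)%:E < +oo ->
  cvgn v /\ (`|limn v - v 0%N|%R)%:E <= \sum_(k <oo) (`|v k.+1 - v k|%R)%:E.
Proof.
set S := \sum_(k <oo) _ => Soo.
have w0 k : 0 <= (`|v k.+1 - v k|%R)%:E by rewrite lee_fin.
have S0 : 0 <= S by exact: nneseries_ge0.
have Sfin : S \is a fin_num by rewrite ge0_fin_numE.
have partial n : (\sum_(0 <= k < n) `|v k.+1 - v k| <= fine S)%R.
  rewrite -lee_fin fineK// -sumEFin /S (nneseries_split 0 n)//.
  by rewrite add0n; apply: leeDl; exact: nneseries_ge0.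
have cv : cvgn (series (telescope v)).
  apply: normed_cvg; apply: nondecreasing_is_cvgn.
    by apply: nondecreasing_series => k _ _; exact: normr_ge0.
  by exists (fine S) => _ [n _ <-]; exact: partial.
have vE n : v n = (v 0%N + series (telescope v) n)%R by exact: eq_sum_telescope.
have cvv : cvgn v.
  rewrite [X in cvgn X](_ : v = (cst (v 0%N) + series (telescope v))%R).
    by apply: is_cvgD => //; exact: is_cvg_cst.
  by apply/funext => n; exact: vE.
split=> //; rewrite -[S]fineK// lee_fin.
have cd : (fun n => `|v n - v 0%N|)%R @ \oo --> (`|limn v - v 0%N|)%R.
  by apply: cvg_norm; apply: cvgB => //; exact: cvg_cst.
rewrite -(cvg_lim (@Rhausdorff R) cd); apply: limr_le.
  by apply/cvg_ex; exists (`|limn v - v 0%N|)%R.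
apply: nearW => n; apply: le_trans (partial n).
rewrite vE addrC addrA [(- _ + _)%R]addrC subrr add0r.
exact: ler_norm_sum.
Qed.

End Gronwall.

(** * The contraction and the truncation of masses *)

Section Contraction.
Context {R : realType}.
Local Notation mu := (@lebesgue_measure R).
Local Notation jmeas f := (measurable_fun setT (fun p : R * R => f p.1 p.2)).
Variables (lambda : R) (f0 : R -> R) (g0 : R * R -> R) (M0 N0 : R).
Hypothesis data : initial_data lambda f0 g0 M0 N0.
Let l0 : (0 < lambda)%R. Proof. exact: coupling_gt0 data. Qed.

(** The mild right-hand side may be infinite on a null set; [fine] sends it to 0 there. *)
Definition mild_map (f : R -> R -> R) (t x : R) : R :=
  fine (mild lambda f0 g0 f t x).

Lemma mild_map_ge0 C f t x : bounded_density C f -> (0 <= mild_map f t x)%R.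
Proof. by move=> fC; rewrite fine_ge0// (mild_ge0 data fC). Qed.

Lemma measurable_mild_map C f : bounded_density C f -> jmeas (mild_map f).
Proof.
by move=> fC; have mm := measurable_mild data fC; rewrite /mild_map; meas.
Qed.

Lemma fine_le_ge0 (y : \bar R) : 0 <= y -> (fine y)%:E <= y.
Proof. by case: y => [r| |]//=; rewrite ?lee_fin// leey. Qed.

Lemma int_mild_map_le C f t T : bounded_density C f -> (0 <= T)%R -> (t <= T)%R ->
  \int[mu]_x (mild_map f t x)%:E <=
  (M0 + (4 * N0 + 4 * lambda * (C ^+ 2 * T)))%:E.
Proof.
move=> fC T0 tT; apply: le_trans _ (int_mild_le data fC T0 tT).
have mm := measurable_mild data fC; have mp := measurable_mild_map fC.
apply: ge0_le_integral; first exact: measurableT.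
- by move=> x _; rewrite lee_fin (mild_map_ge0 _ _ fC).
- by meas.
- by meas.
by move=> x _; apply: fine_le_ge0; exact: (mild_ge0 data fC).
Qed.

Lemma density_mild_map C f : bounded_density C f -> density (mild_map f).
Proof.
move=> fC; split; first exact: measurable_mild_map fC.
  by move=> t x; exact: mild_map_ge0 fC.
move=> t; apply: (@le_lt_trans _ _ _ _ _ _ (ltry _)).
apply: (int_mild_map_le (T := Num.max 0%R t) fC); first by rewrite le_max lexx.
by rewrite le_max lexx orbT.
Qed.

Lemma mild_map_contract C f g t T : (0 <= T)%R -> (t <= T)%R ->
  bounded_density C f -> bounded_density C g ->
  dist1 (mild_map f) (mild_map g) t <=
  (2 * lip_const lambda M0 N0 C T)%:E * \int[mu]_(s in `[0%R, t]) dist1 f g s.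
Proof.
move=> T0 tT fC gC.
pose G := mild_gap lambda f0 g0.
have G0 (u v : R -> R -> R) : bounded_density C u -> bounded_density C v ->
  forall x, 0 <= G u v t x by move=> uC vC x; exact: (mild_gap_ge0 data uC vC).
have mG (u v : R -> R -> R) : bounded_density C u -> bounded_density C v ->
  measurable_fun setT (G u v t).
  by move=> uC vC; exact: (measurable_mild_gap data uC vC).
have mf := measurable_mild_map fC; have mg := measurable_mild_map gC.
apply: (@le_trans _ _ (\int[mu]_x (G f g t x + G g f t x))).
  apply: ge0_le_integral; first exact: measurableT.
  - by move=> x _; rewrite lee_fin.
  - by meas.
  - by apply: emeasurable_funD; exact: mG.
  move=> x _; apply: fine_dist_le.
  - exact: (mild_ge0 data fC).
  - exact: (mild_ge0 data gC).
  - by apply: adde_ge0; exact: G0.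
  - apply: (le_trans (mild_lip_pointwise data fC gC t x)).
    by apply: leeD => //; apply: leeDl; exact: G0.
  - apply: (le_trans (mild_lip_pointwise data gC fC t x)).
    by apply: leeD => //; apply: leeDr; exact: G0.
rewrite ge0_integralD//; first last.
- exact: mG.
- by move=> x _; exact: G0.
- exact: mG.
- by move=> x _; exact: G0.
have -> : (2 * lip_const lambda M0 N0 C T =
  lip_const lambda M0 N0 C T + lip_const lambda M0 N0 C T)%R by ring.
have L0 : 0 <= (lip_const lambda M0 N0 C T)%:E.
  by rewrite lee_fin (lip_const_ge0 data fC).
rewrite EFinD ge0_muleDl//; apply: leeD; first exact: (int_mild_gap_le data fC gC T0 tT).
apply: (le_trans (int_mild_gap_le data gC fC T0 tT)).
apply: lee_wpmul2l => //; rewrite le_eqVlt; apply/orP; left; apply/eqP.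
by apply: eq_integral => s _; exact: dist1C.
Qed.

End Contraction.

Section Truncation.
Context {R : realType}.
Local Notation mu := (@lebesgue_measure R).
Local Notation jmeas f := (measurable_fun setT (fun p : R * R => f p.1 p.2)).
Variable K : R.
Hypothesis K0 : (0 < K)%R.

(** Rescaling a density so that its mass is at most [K].  Composed with
    [mild_map] it gives a map that is Lipschitz on all densities, and it is the
    identity on densities of mass at most [K]. *)
Definition cutoff (f : R -> R -> R) (t : R) : R := (K / Num.max K (mass f t))%R.

Definition truncate (f : R -> R -> R) (t x : R) : R := (f t x * cutoff f t)%R.

Let max_gt0 (m : R) : (0 < Num.max K m)%R.
Proof. by rewrite lt_max K0. Qed.
Let ratio_ge0 (m : R) : (0 <= K / Num.max K m)%R.
Proof. by rewrite divr_ge0 ?ltW. Qed.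
Let ratio_le1 (m : R) : (K / Num.max K m <= 1)%R.
Proof. by rewrite ler_pdivrMr// mul1r le_max lexx. Qed.

Let measurable_ratio f : density f ->
  measurable_fun setT (cutoff f).
Proof.
move=> fd; have mm := measurable_mass fd.
have mr : measurable_fun setT (fun m : R => K / Num.max K m)%R.
  apply: nonincreasing_measurable => // m n mn.
  by rewrite ler_pM2l// lef_pV2 ?posrE// ge_max !le_max lexx mn orbT.
exact: (measurableT_comp mr mm).
Qed.

Lemma truncate_id f t : (mass f t <= K)%R -> truncate f t = f t.
Proof.
move=> fK; apply/funext => x; rewrite /truncate /cutoff (max_idPl fK).
by rewrite divff ?mulr1// gt_eqF.
Qed.

Lemma bounded_truncate f : density f -> bounded_density K (truncate f).
Proof.
move=> fd; case: (fd) => mf f_ge0 foo.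
have mr := measurable_ratio fd; split.
- by rewrite /truncate; meas.
- by move=> t x; rewrite mulr_ge0// ratio_ge0.
move=> t; rewrite /truncate.
under eq_integral do rewrite EFinM.
rewrite ge0_integralZr//; last 3 first.
- by meas.
- by move=> x _; rewrite lee_fin.
- by rewrite lee_fin ratio_ge0.
rewrite -(massE fd) -EFinM lee_fin /cutoff mulrA ler_pdivrMr// mulrC ler_pM2l//.
by rewrite le_max lexx orbT.
Qed.

Lemma mass_dist_real (f g : R -> R -> R) t : density f -> density g ->
  (`|mass f t - mass g t|%R)%:E <= dist1 f g t.
Proof.
move=> fd gd; have := dist1_ge0 f g t.
have h1 := mass_le_dist t fd gd; have := mass_le_dist t gd fd; rewrite dist1C.
move: h1; case: (dist1 f g t) => [r| |]//; rewrite ?leey//.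
by rewrite -!EFinD !lee_fin ler_norml => h1 h2 r0; lra.
Qed.

(** One unit of the constant 2 is the change of the density, the other the
    change of the rescaling factor; the latter is multiplied by the mass of
    [g], and [n / Num.max K n <= 1] absorbs that mass. *)
Lemma truncate_lip f g t : density f -> density g ->
  dist1 (truncate f) (truncate g) t <= 2%:E * dist1 f g t.
Proof.
move=> fd gd; case: (fd) (gd) => mf f_ge0 _ [mg g_ge0 _].
pose a := cutoff f t; pose b := cutoff g t.
have mrf := measurable_ratio fd; have mrg := measurable_ratio gd.
have gab : (mass g t * `|a - b| <= `|mass f t - mass g t|)%R.
  rewrite /a /b /cutoff; set m := mass f t; set n := mass g t.
  have n0 : (0 <= n)%R := mass_ge0 gd t.
  have -> : (K / Num.max K m - K / Num.max K n =
    (K / Num.max K m) * ((Num.max K n - Num.max K m) / Num.max K n))%R.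
    by field; rewrite !gt_eqF.
  rewrite normrM (ger0_norm (ratio_ge0 m)) normrM [X in (_ * (_ * (_ * X)))%R]ger0_norm.
    2: by rewrite invr_ge0 ltW.
  have h1 : (n / Num.max K n <= 1)%R.
    by rewrite ler_pdivrMr// mul1r le_max lexx orbT.
  have h2 : (`|Num.max K n - Num.max K m| <= `|m - n|)%R.
    rewrite distrC; rewrite /Num.max; case: ltP => Km; case: ltP => Kn.
    - by [].
    - by rewrite !ger0_norm; lra.
    - by rewrite !ler0_norm; lra.
    - by rewrite subrr normr0.
  have h3 : (0 <= n / Num.max K n)%R by rewrite divr_ge0// ltW.
  have -> : (n * (K / Num.max K m * (`|Num.max K n - Num.max K m| / Num.max K n)) =
     (n / Num.max K n) * (K / Num.max K m) * `|Num.max K n - Num.max K m|)%R by ring.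
  apply: le_trans h2; rewrite -[leRHS]mul1r ler_wpM2r//.
  by rewrite mulr_ile1.
apply: (@le_trans _ _ (dist1 f g t + \int[mu]_x (g t x * `|a - b|)%:E)).
  rewrite /dist1 -ge0_integralD//; first last.
  - by meas.
  - by move=> x _; rewrite lee_fin mulr_ge0.
  - by meas.
  apply: ge0_le_integral; first exact: measurableT.
  - by move=> x _; rewrite lee_fin.
  - by rewrite /truncate; meas.
  - by meas.
  move=> x _; rewrite -EFinD lee_fin /truncate -/a -/b.
  have -> : (f t x * a - g t x * b = (f t x - g t x) * a + g t x * (a - b))%R by ring.
  apply: (le_trans (ler_normD _ _)); apply: lerD.
    by rewrite normrM (ger0_norm (ratio_ge0 _)) ler_piMr.
  by rewrite normrM (ger0_norm (g_ge0 _ _)).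
have -> : 2%:E = 1 + 1 :> \bar R by rewrite -EFinD.
rewrite ge0_muleDl// mul1e; apply: leeD => //.
under eq_integral do rewrite EFinM.
rewrite ge0_integralZr//; last 2 first.
- by meas.
- by move=> x _; rewrite lee_fin.
by rewrite -(massE gd) -EFinM (le_trans _ (mass_dist_real t fd gd))// lee_fin.
Qed.

End Truncation.

(** * Picard iteration *)

Section Distances.
Context {R : realType}.
Local Notation mu := (@lebesgue_measure R).
Local Notation jmeas f := (measurable_fun setT (fun p : R * R => f p.1 p.2)).

Lemma dist1_triangle (f g h : R -> R -> R) t : jmeas f -> jmeas g -> jmeas h ->
  dist1 f h t <= dist1 f g t + dist1 g h t.
Proof.
move=> mf mg mh; rewrite /dist1 -ge0_integralD//; [|by meas..].
apply: ge0_le_integral => //; [by meas|by meas|].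
by move=> x _; rewrite -EFinD lee_fin ler_distD.
Qed.

Lemma dist1_eq0 (f g : R -> R -> R) t : jmeas f -> jmeas g ->
  dist1 f g t <= 0 -> {ae mu, forall x, f t x = g t x}.
Proof.
move=> mf mg fg.
have mh : measurable_fun setT (fun x => (f t x - g t x)%:E) by meas.
have /(ae_eq_integral_abs mu measurableT mh) :
    \int[mu]_x `|(f t x - g t x)%:E| = 0.
  by apply/eqP; rewrite eq_le fg/= dist1_ge0.
by apply: ae_imply => x /(_ I)[] /eqP; rewrite subr_eq0 => /eqP.
Qed.

Lemma le0_of_geometric (x : \bar R) (D : R) :
  (forall n, x <= (D / 2 ^+ n)%:E) -> x <= 0.
Proof.
move=> H; apply/lee_addgt0Pr => e e0; rewrite add0e.
have D0 : (D <= `|D|)%R by exact: ler_norm.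
pose n := Num.truncn (`|D| / e).
apply: (le_trans (H n)); rewrite lee_fin ler_pdivrMr ?exprn_gt0//.
have h1 : (`|D| / e < n.+1%:R)%R by exact: truncnS_gt.
have h2 : (n.+1%:R <= 2 ^+ n :> R)%R by rewrite -natrX ler_nat ltn_expl.
rewrite ltr_pdivrMr// in h1; rewrite mulrC.
apply: (le_trans D0); apply: (le_trans (ltW h1)).
by rewrite ler_wpM2r// ltW.
Qed.

Lemma geometric_series_le (B : R) (n : nat) (a : nat -> \bar R) : (0 <= B)%R ->
  (forall k, 0 <= a k) -> (forall k, a k <= (B / 2 ^+ (n + k))%:E) ->
  \sum_(k <oo) a k <= (2 * B / 2 ^+ n)%:E.
Proof.
move=> B0 a0 aB; apply: lime_le; first exact: is_cvg_nneseries.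
apply: nearW => m.
apply: (@le_trans _ _ (2 * B / 2 ^+ n - 2 * B / 2 ^+ (n + m))%:E); last first.
  by rewrite lee_fin gerBl divr_ge0 ?mulr_ge0// exprn_ge0.
elim: m => [|m IH]; first by rewrite big_geq// addn0 subrr.
rewrite big_nat_recr//=; apply: (le_trans (leeD IH (aB m))).
rewrite -EFinD lee_fin addnS exprS le_eqVlt; apply/orP; left; apply/eqP.
by field; rewrite !expf_neq0.
Qed.

End Distances.

Section Picard.
Context {R : realType}.
Local Notation mu := (@lebesgue_measure R).
Local Notation jmeas f := (measurable_fun setT (fun p : R * R => f p.1 p.2)).
Variables (lambda : R) (f0 : R -> R) (g0 : R * R -> R) (M0 N0 : R).
Hypothesis data : initial_data lambda f0 g0 M0 N0.
Variable K : R.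
Hypothesis K0 : (0 < K)%R.

Definition truncated_map (f : R -> R -> R) : R -> R -> R :=
  mild_map lambda f0 g0 (truncate K f).

Lemma density_truncated_map f : density f -> density (truncated_map f).
Proof. by move=> fd; exact: (density_mild_map data (bounded_truncate K0 fd)). Qed.

Let L (T : R) := lip_const lambda M0 N0 K T.

Lemma truncated_map_contract f g t T : (0 <= T)%R -> (t <= T)%R ->
  density f -> density g ->
  dist1 (truncated_map f) (truncated_map g) t <=
  (4 * L T)%:E * \int[mu]_(s in `[0%R, t]) dist1 f g s.
Proof.
move=> T0 tT fd gd.
have fK := bounded_truncate K0 fd; have gK := bounded_truncate K0 gd.
have [mf _ _] := fd; have [mg _ _] := gd.
have [mtf _ _] := fK; have [mtg _ _] := gK.
have mD := measurable_dist1 mf mg; have mDt := measurable_dist1 mtf mtg.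
have L0 : (0 <= L T)%R by exact: (lip_const_ge0 data fK T0).
apply: (le_trans (mild_map_contract data T0 tT fK gK)).
have -> : (4 * L T = 2 * L T * 2)%R by ring.
rewrite [leRHS](_ : _ = (2 * L T)%:E * (2%:E *
    \int[mu]_(s in `[0%R, t]) dist1 f g s)); last by rewrite [in LHS]EFinM muleA.
apply: lee_wpmul2l; first by rewrite lee_fin mulr_ge0.
rewrite -ge0_integralZ//; last by move=> s; exact: dist1_ge0.
apply: ge0_le_integral; first exact: measurable_itv.
- by move=> s _; exact: dist1_ge0.
- exact: measurable_funTS.
- by apply: measurable_funTS; meas.
- by move=> s _; exact: truncate_lip.
Qed.

Definition picard (n : nat) : R -> R -> R := iter n truncated_map (fun _ _ => 0%R).

Lemma density_picard n : density (picard n).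
Proof.
elim: n => [|n IH]; last exact: density_truncated_map.
split; [exact: measurable_cst|by []|].
by move=> t; rewrite integral0 ltry.
Qed.

Let meas_picard n : jmeas (picard n).
Proof. by case: (density_picard n). Qed.

(** [volterra_decay] makes the increments geometrically small on [[0, T]]; at
    negative times the time integral is empty, so all but the first vanish. *)
Lemma picard_decay (T : R) : (0 <= T)%R -> exists2 B : R, (0 <= B)%R &
  forall n t, (t <= T)%R -> dist1 (picard n.+1) (picard n) t <= (B / 2 ^+ n)%:E.
Proof.
move=> T0; pose A := (M0 + (4 * N0 + 4 * lambda * (K ^+ 2 * T)))%R.
have d0K : bounded_density K (truncate K (picard 0)).
  exact: (bounded_truncate K0 (density_picard 0)).
have A0 : (0 <= A)%R by exact: (lip_const_damping_ge0 data d0K T0).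
have L0 : (0 <= L T)%R by exact: (lip_const_ge0 data d0K T0).
pose c := (4 * L T + 1)%R.
have c0 : (0 < c)%R by rewrite ltr_wpDl// mulr_ge0.
pose d n t := dist1 (picard n.+1) (picard n) t.
have md n : measurable_fun setT (d n) by exact: measurable_dist1.
have dge0 n t : 0 <= d n t by exact: dist1_ge0.
have dA t : (t <= T)%R -> d 0%N t <= A%:E.
  move=> tT; apply: le_trans _ (int_mild_map_le data d0K T0 tT).
  rewrite le_eqVlt; apply/orP; left; apply/eqP; apply: eq_integral => x _.
  by rewrite /= subr0 ger0_norm// (mild_map_ge0 data _ _ d0K).
have dS n t : (t <= T)%R -> d n.+1 t <= c%:E * \int[mu]_(s in `[0%R, t]) d n s.
  move=> tT; apply: (le_trans (truncated_map_contract T0 tT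
    (density_picard n.+1) (density_picard n))).
  apply: lee_wpmul2r; first by apply: integral_ge0 => s _; exact: dge0.
  by rewrite lee_fin /c lerDl.
exists (A * expR (2 * c * T))%R; first by rewrite mulr_ge0// expR_ge0.
move=> n t tT; have [t0|t0] := leP 0%R t.
  have H : d n t <= (A / 2 ^+ n * expR (2 * c * t))%:E.
    apply: (@volterra_decay _ (fun=> True) d A c T) => //.
    - exact: aeW.
    - by move=> s _ /andP[_]; exact: dA.
    - by move=> k s _ /andP[_]; exact: dS.
    - by rewrite t0.
  apply: (le_trans H).
  rewrite lee_fin mulrAC ler_wpM2r ?invr_ge0 ?exprn_ge0// ler_wpM2l//.
  by rewrite ler_expR ler_wpM2l// mulr_ge0// ltW.
case: n => [|n].
  apply: (le_trans (dA t tT)); rewrite lee_fin expr0 divr1 ler_peMr//.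
  by rewrite -expR0 ler_expR !mulr_ge0// ltW.
apply: (le_trans (dS n t tT)); rewrite set_itv_ge ?bnd_simp -?ltNge//.
by rewrite integral_set0 mule0 lee_fin divr_ge0 ?mulr_ge0 ?expR_ge0 ?exprn_ge0.
Qed.

(** The upper limit is measurable without any convergence; the absolute value
    keeps it nonnegative at the points where the iterates do not converge. *)
Definition picard_limit (t x : R) : R :=
  `|fine (limn_esup (fun n => (picard n t x)%:E))|%R.

Lemma measurable_picard_limit : jmeas picard_limit.
Proof.
rewrite /picard_limit; mstep; mstep.
apply: (measurable_fun_limn_esup (f := fun n (p : R * R) => (picard n p.1 p.2)%:E)).
by move=> n; have := meas_picard n; meas.
Qed.

(** Where the series of increments diverges the bound is trivial, so no null
    set has to be removed before integrating. *)
Lemma picard_limit_tail n t x : (`|picard_limit t x - picard n t x|%R)%:E <=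
  \sum_(k <oo) (`|picard (n + k).+1 t x - picard (n + k) t x|%R)%:E.
Proof.
set S := \sum_(k <oo) _; have [Soo|] := ltP S +oo; last first.
  by rewrite leye_eq => /eqP ->; rewrite leey.
pose v k := picard (n + k) t x.
have SE : S = \sum_(k <oo) (`|v k.+1 - v k|%R)%:E.
  by apply: eq_eseriesr => k _; rewrite /v addnS.
rewrite SE in Soo; have [cv vS] := cvg_of_summable_increments Soo.
rewrite SE; suff -> : picard_limit t x = limn v by move: vS; rewrite /v addn0.
have cu : (fun m => picard m t x) @ \oo --> limn v.
  by rewrite -(cvg_shiftn n); under eq_fun do rewrite addnC; exact: cv.
have lim0 : (0 <= limn v)%R.
  apply: limr_ge => //; apply: nearW => k.
  by have [_ pk _] := density_picard (n + k); exact: pk.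
have ce : (fun m => (picard m t x)%:E) @ \oo --> (limn v)%:E.
  by apply: cvg_EFin => //; exact: nearW.
rewrite /picard_limit is_cvg_limn_esupE; last by apply/cvg_ex; exists (limn v)%:E.
by rewrite (cvg_lim (@ereal_hausdorff R) ce)/= ger0_norm.
Qed.

Lemma picard_limit_dist (T : R) : (0 <= T)%R -> exists2 B : R, (0 <= B)%R &
  forall n t, (t <= T)%R -> dist1 picard_limit (picard n) t <= (B / 2 ^+ n)%:E.
Proof.
move=> T0; have [B B0 HB] := picard_decay T0.
exists (2 * B)%R; first by rewrite mulr_ge0.
move=> n t tT; have ml := measurable_picard_limit; have mp := meas_picard n.
have ms k : measurable_fun setT
    (fun x => (`|picard (n + k).+1 t x - picard (n + k) t x|%R)%:E).
  by have := meas_picard (n + k).+1; have := meas_picard (n + k); meas.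
apply: (@le_trans _ _ (\int[mu]_x \sum_(k <oo)
    (`|picard (n + k).+1 t x - picard (n + k) t x|%R)%:E)).
  apply: ge0_le_integral; first exact: measurableT.
  - by move=> x _; rewrite lee_fin.
  - by meas.
  - apply: ge0_emeasurable_sum => [k x _ _|k _]; last exact: ms.
    by rewrite lee_fin.
  - by move=> x _; exact: picard_limit_tail.
rewrite integral_nneseries//; apply: geometric_series_le => //.
- by move=> k; exact: dist1_ge0.
- by move=> k; exact: HB.
Qed.

Lemma density_picard_limit : density picard_limit.
Proof.
have ml := measurable_picard_limit; have mp := meas_picard 0.
split => //; first by move=> t x; exact: normr_ge0.
move=> t; have T0 : (0 <= Num.max 0 t)%R by rewrite le_max lexx.
have [B B0 HB] := picard_limit_dist T0.
have tT : (t <= Num.max 0 t)%R by rewrite le_max lexx orbT.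
apply: (@le_lt_trans _ _ (dist1 picard_limit (picard 0) t)); last first.
  exact: le_lt_trans (HB 0%N t tT) (ltry _).
apply: ge0_le_integral; first exact: measurableT.
- by move=> x _; rewrite lee_fin; exact: normr_ge0.
- by meas.
- by meas.
- by move=> x _; rewrite /= subr0 lee_fin ler_norm.
Qed.

(** The limit and its image are both geometrically close to every iterate. *)
Lemma picard_limit_fixpoint t :
  {ae mu, forall x, picard_limit t x = truncated_map picard_limit t x}.
Proof.
have ml := measurable_picard_limit; have dl := density_picard_limit.
have [mtl _ _] := density_truncated_map dl.
have [mp _ _] := density_picard 0.
apply: dist1_eq0 => //; pose T := Num.max 0%R t.
have T0 : (0 <= T)%R by rewrite le_max lexx.
have tT : (t <= T)%R by rewrite le_max lexx orbT.
have [B B0 HB] := picard_limit_dist T0.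
have L0 : (0 <= L T)%R by exact: (lip_const_ge0 data (bounded_truncate K0 dl) T0).
apply: (@le0_of_geometric _ _ (B + 4 * L T * (B * T))%R) => n.
have mpn := meas_picard n; have mpS := meas_picard n.+1.
apply: (le_trans (dist1_triangle t ml mpS mtl)).
rewrite mulrDl EFinD; apply: leeD.
  apply: (le_trans (HB n.+1 t tT)); rewrite lee_fin ler_wpM2l//.
  by rewrite lef_pV2 ?posrE ?exprn_gt0// ler_weXn2l// ler1n.
apply: (le_trans (truncated_map_contract T0 tT (density_picard n) dl)).
rewrite [leRHS](_ : _ = (4 * L T)%:E * (B * T / 2 ^+ n)%:E); last first.
  by rewrite -EFinM [in RHS]mulrA.
apply: lee_wpmul2l; first by rewrite lee_fin mulr_ge0.
apply: (@le_trans _ _ (\int[mu]_(s in `[0%R, T]) (B / 2 ^+ n)%:E)).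
  have Bn : (0 <= B / 2 ^+ n)%R by rewrite divr_ge0// exprn_ge0.
  apply: (@le_trans _ _ (\int[mu]_(s in `[0%R, t]) (B / 2 ^+ n)%:E)).
    apply: ge0_le_integral; first exact: measurable_itv.
    - by move=> s _; exact: dist1_ge0.
    - by apply: measurable_funTS; exact: measurable_dist1.
    - by apply: measurable_funTS; meas.
    move=> s /=; rewrite in_itv/= => /andP[_ st]; rewrite dist1C.
    by apply: HB; exact: le_trans tT.
  apply: ge0_subset_integral => //.
  by apply: subset_itvl; rewrite bnd_simp.
by rewrite integral_itv_cst// subr0 lee_fin mulrAC.
Qed.

End Picard.

(** * Balance of mass *)

Section Relaxation.
Context {R : realType}.
Local Notation mu := (@lebesgue_measure R).
Variables (c C : R) (m : R -> R) (a : \bar R) (sigma : R -> \bar R).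
Hypotheses (c0 : (0 <= c)%R) (mm : measurable_fun setT m).
Hypotheses (m0 : forall t, (0 <= m t)%R) (mC : forall t, (m t <= C)%R).
Hypotheses (a0 : 0 <= a) (ms : measurable_fun setT sigma).
Hypothesis s0 : forall t, 0 <= sigma t.

Let E s t := expR (- (c * action m s t)).
Let mE : measurable_fun setT (fun p : R * R => E p.1 p.2).
Proof. by rewrite /E; have ma := measurable_action mm m0; meas. Qed.
Let E0 s t : (0 <= E s t)%R. Proof. exact: expR_ge0. Qed.

Let Y t := (E 0 t)%:E * a + \int[mu]_(s in `[0%R, t]) ((E s t)%:E * sigma s).

(** [Y] is the variation-of-constants formula for [Y' = - c m Y + sigma], and the
    claim is the time integral of this equation.  For measurable coefficients
    it is obtained from Tonelli: each unit supplied at time [s] has lost at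
    most [1 - E s t] by time [t]. *)
Lemma relaxation_balance t : (0 <= t)%R ->
  Y t + \int[mu]_(u in `[0%R, t]) ((c * m u)%:E * Y u) <=
  a + \int[mu]_(s in `[0%R, t]) sigma s.
Proof.
move=> t0.
have loss s : (s <= t)%R ->
  \int[mu]_(u in `[s, t]) (c * m u * E s u)%:E <= (1 - E s t)%:E.
  exact: int_loss_le.
have cm0 u : 0 <= (c * m u)%:E by rewrite lee_fin mulr_ge0.
have k0 s u : 0 <= (c * m u * E s u)%:E by rewrite lee_fin !mulr_ge0.
have Es0 s u : 0 <= (E s u)%:E * sigma s by rewrite mule_ge0// lee_fin.
have I0 u : 0 <= \int[mu]_(s in `[0%R, u]) ((E s u)%:E * sigma s).
  exact: integral_ge0.
have mI : measurable_fun setT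
    (fun u : R => \int[mu]_(s in `[0%R, u]) ((E s u)%:E * sigma s)).
  apply: measurable_pint_itv; [by meas|by meas|by meas|].
  by move=> u s; exact: Es0.
have YE : \int[mu]_(u in `[0%R, t]) ((c * m u)%:E * Y u) =
  a * \int[mu]_(u in `[0%R, t]) (c * m u * E 0 u)%:E +
  \int[mu]_(s in `[0%R, t])
     (sigma s * \int[mu]_(u in `[s, t]) (c * m u * E s u)%:E).
  transitivity (\int[mu]_(u in `[0%R, t]) (a * (c * m u * E 0 u)%:E +
      (c * m u)%:E * \int[mu]_(s in `[0%R, u]) ((E s u)%:E * sigma s))).
    apply: eq_integral => u _; rewrite /Y ge0_muleDr//; last first.
      by rewrite mule_ge0// lee_fin.
    by congr (_ + _); rewrite EFinM muleA muleC.
  pose h1 (u : R) : \bar R := a * (c * m u * E 0 u)%:E.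
  pose h2 (u : R) : \bar R :=
    (c * m u)%:E * \int[mu]_(s in `[0%R, u]) ((E s u)%:E * sigma s).
  have mh1 : measurable_fun setT h1 by rewrite /h1; meas.
  have mh2 : measurable_fun setT h2 by rewrite /h2; meas.
  have h10 u : 0 <= h1 u by rewrite mule_ge0.
  have h20 u : 0 <= h2 u by rewrite mule_ge0.
  apply: (etrans (ge0_integral_itvD 0 t mh1 mh2 h10 h20)).
  apply: (congr2 adde).
    by rewrite ge0_integralZl//; apply: measurable_funTS; meas.
  pose k (u s : R) := (c * m u)%:E * ((E s u)%:E * sigma s).
  have mk : measurable_fun setT (fun p : R * R => k p.1 p.2) by rewrite /k; meas.
  have kk0 u s : 0 <= k u s by rewrite mule_ge0.
  transitivity (\int[mu]_(u in `[0%R, t]) \int[mu]_(s in `[0%R, u]) k u s).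
    apply: eq_integral => u _; rewrite ge0_integralZl//.
    by apply: measurable_funTS; meas.
  rewrite (tonelli_triangle t mk kk0); apply: eq_integral => s _.
  rewrite -ge0_integralZl//; last by apply: measurable_funTS; meas.
  by apply: eq_integral => u _; rewrite /k EFinM muleA muleC.
rewrite YE /Y addeACA; apply: leeD.
  rewrite muleC -ge0_muleDr ?lee_fin ?E0//; last exact: integral_ge0.
  rewrite -[leRHS]mule1; apply: lee_wpmul2l => //.
  apply: (@le_trans _ _ ((E 0 t)%:E + (1 - E 0 t)%:E)).
    by apply: leeD => //; exact: loss.
  by rewrite -EFinD lee_fin addrC subrK.
have mL : measurable_fun setT (fun s : R => \int[mu]_(u in `[s, t]) (c * m u * E s u)%:E).
  by apply: measurable_pint_itv; [by meas|by meas|by meas|move=> *; exact: k0].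
have L0 s : 0 <= \int[mu]_(u in `[s, t]) (c * m u * E s u)%:E.
  exact: integral_ge0.
rewrite -ge0_integralD//; first last.
- by apply: measurable_funTS; meas.
- by move=> s _; rewrite mule_ge0.
- by apply: measurable_funTS; meas.
apply: ge0_le_integral; first exact: measurable_itv.
- by move=> s _; rewrite adde_ge0// mule_ge0.
- by apply: measurable_funTS; meas.
- by apply: measurable_funTS; meas.
move=> s /=; rewrite in_itv/= => /andP[_ st].
rewrite muleC -ge0_muleDr ?lee_fin ?E0//.
rewrite -[leRHS]mule1; apply: lee_wpmul2l => //.
apply: (@le_trans _ _ ((E s t)%:E + (1 - E s t)%:E)).
  by apply: leeD => //; exact: loss.
by rewrite -EFinD lee_fin addrC subrK.
Qed.

End Relaxation.

Section Budget.
Context {R : realType}.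
Local Notation mu := (@lebesgue_measure R).
Local Notation jmeas f := (measurable_fun setT (fun p : R * R => f p.1 p.2)).
Variables (f : R -> R -> R).
Hypothesis fd : density f.
Let mf : jmeas f. Proof. by case: fd. Qed.
Let f_ge0 : forall t x, (0 <= f t x)%R. Proof. by case: fd. Qed.

(** Pairs with [y < x] that were created at some time [r] with a gap too large to
    be closed by time [t]. *)
Definition free_pairs (t : R) : \bar R :=
  \int[mu]_(r in `[0%R, t]) \int[mu]_y \int[mu]_x
    (if (y + (t - r) < x)%R then (f r x * f r y)%:E else 0).

(** At each creation time, the pairs that have met and those still free fill the
    half plane [y <= x], which holds half of all ordered pairs. *)
Lemma pair_budget t :
  (\int[mu]_(s in `[0%R, t]) \int[mu]_x collision f f s x + free_pairs t) +
  (\int[mu]_(s in `[0%R, t]) \int[mu]_x collision f f s x + free_pairs t) <=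
  \int[mu]_(r in `[0%R, t]) (mass f r * mass f r)%:E.
Proof.
have ff0 r x y : 0 <= (f r x * f r y)%:E by rewrite lee_fin mulr_ge0.
have mm := measurable_mass fd.
pose u (r : R) := \int[mu]_y \int[mu]_(x in `[y, (y + (t - r))%R]) (f r x * f r y)%:E.
pose v (r : R) := \int[mu]_y \int[mu]_x
    (if (y + (t - r) < x)%R then (f r x * f r y)%:E else 0).
have u0 r : 0 <= u r by do 2![apply: integral_ge0 => ? _].
have v0 r : 0 <= v r by do 2![apply: integral_ge0 => ? _]; case: ifP.
have mu1 : measurable_fun setT (fun p : R * R =>
    \int[mu]_(x in `[p.2, (p.2 + (t - p.1))%R]) (f p.1 x * f p.1 p.2)%:E).
  by apply: measurable_pint_itv; [by meas|by meas|by meas|].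
have mv1 : measurable_fun setT (fun p : R * R =>
    \int[mu]_x (if (p.2 + (t - p.1) < x)%R then (f p.1 x * f p.1 p.2)%:E else 0)).
  by apply: measurable_pint; [by meas|move=> ? ?; case: ifP].
have mu2 : measurable_fun setT u.
  by apply: measurable_pint => // r y; exact: integral_ge0.
have mv2 : measurable_fun setT v.
  by apply: measurable_pint => // r y; apply: integral_ge0 => x _; case: ifP.
have -> : \int[mu]_(s in `[0%R, t]) \int[mu]_x collision f f s x + free_pairs t =
    \int[mu]_(r in `[0%R, t]) (u r + v r).
  have E1 : \int[mu]_(s in `[0%R, t]) \int[mu]_x collision f f s x =
      \int[mu]_(r in `[0%R, t]) u r by exact: int_collision.
  have E2 : free_pairs t = \int[mu]_(r in `[0%R, t]) v r := erefl.
  by rewrite E1 E2 (ge0_integral_itvD 0 t mu2 mv2 u0 v0).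
have uv0 r : 0 <= u r + v r by exact: adde_ge0.
have muv : measurable_fun setT (fun r => u r + v r).
  exact: (emeasurable_funD mu2 mv2).
rewrite -ge0_integralD//; try exact: measurable_funTS.
apply: ge0_le_integral; first exact: measurable_itv.
- by move=> r _; exact: adde_ge0.
- by apply: measurable_funTS; exact: emeasurable_funD.
- by apply: measurable_funTS; meas.
move=> r /=; rewrite in_itv/= => /andP[r0 rt].
have mfr : measurable_fun setT (f r) by meas.
rewrite EFinM (massE fd) -(half_plane_mass mfr (f_ge0 r)).
suff h : u r + v r <= \int[mu]_y \int[mu]_x
    (if (y <= x)%R then (f r x * f r y)%:E else 0) by exact: leeD.
pose ui (y : R) := \int[mu]_(x in `[y, (y + (t - r))%R]) (f r x * f r y)%:E.
pose vi (y : R) := \int[mu]_x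
    (if (y + (t - r) < x)%R then (f r x * f r y)%:E else 0).
have mui : measurable_fun setT ui.
  exact: (measurableT_comp mu1 (pair1_measurable r)).
have mvi : measurable_fun setT vi.
  exact: (measurableT_comp mv1 (pair1_measurable r)).
have ui0 y : 0 <= ui y by exact: integral_ge0.
have vi0 y : 0 <= vi y by apply: integral_ge0 => x _; case: ifP.
have -> : u r + v r = \int[mu]_y (ui y + vi y).
  by apply/esym; apply: ge0_integralD.
apply: ge0_le_integral; first exact: measurableT.
- by move=> y _; exact: adde_ge0.
- exact: emeasurable_funD.
- by apply: measurable_pint; [by meas|move=> ? ?; case: ifP].
move=> y _; rewrite /ui /vi integral_itv_if -ge0_integralD//; first last.
- by meas.
- by move=> x _; case: ifP.
- by meas.
- by move=> x _; case: ifP.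
apply: ge0_le_integral; first exact: measurableT.
- by move=> x _; apply: adde_ge0; case: ifP.
- by meas.
- by meas.
move=> x _; have [yx|xy] := leP y x => /=.
  by case: leP => _; rewrite ?adde0 ?add0e.
by rewrite add0e ifF//; apply/negbTE; rewrite -leNgt; lra.
Qed.

End Budget.

(** * Existence of a global density *)

Section Global.
Context {R : realType}.
Local Notation mu := (@lebesgue_measure R).
Local Notation jmeas f := (measurable_fun setT (fun p : R * R => f p.1 p.2)).
Variables (lambda : R) (f0 : R -> R) (g0 : R * R -> R) (M0 N0 : R).
Hypothesis data : initial_data lambda f0 g0 M0 N0.
Let l0 : (0 < lambda)%R. Proof. exact: coupling_gt0 data. Qed.

Let f0_mass_ge0 : 0 <= \int[mu]_x (f0 x)%:E.
Proof. by apply: integral_ge0 => x _; rewrite lee_fin (f0_nonneg data). Qed.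

Lemma mild_balance C b t : bounded_density C b -> (0 <= t)%R ->
  \int[mu]_x mild lambda f0 g0 b t x +
  \int[mu]_(u in `[0%R, t])
    ((2 * lambda * mass b u)%:E * \int[mu]_x mild lambda f0 g0 b u x) <=
  \int[mu]_x (f0 x)%:E +
  \int[mu]_(s in `[0%R, t]) \int[mu]_x source lambda g0 b s x.
Proof.
move=> bC t0.
have ms := measurable_source data bC; have s0 := source_ge0 data bC.
pose sigma s := \int[mu]_x source lambda g0 b s x.
have msig : measurable_fun setT sigma by exact: measurable_pint.
have sig0 s : 0 <= sigma s by exact: integral_ge0.
have l2 : (0 <= 2 * lambda)%R by rewrite mulr_ge0// ltW.
pose Y u := (expR (- (2 * lambda * action (mass b) 0 u)))%:E *
    \int[mu]_x (f0 x)%:E +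
  \int[mu]_(s in `[0%R, u])
    ((expR (- (2 * lambda * action (mass b) s u)))%:E * sigma s).
have YE u : \int[mu]_x mild lambda f0 g0 b u x = Y u.
  apply: (etrans (int_mildE data bC u)); rewrite dampingE.
  apply: (congr2 adde); first exact: erefl.
  by apply: eq_integral => s _; rewrite dampingE.
have H : Y t + \int[mu]_(u in `[0%R, t]) ((2 * lambda * mass b u)%:E * Y u) <=
    \int[mu]_x (f0 x)%:E + \int[mu]_(s in `[0%R, t]) sigma s.
  exact: (relaxation_balance l2 (measurable_mass bC) (mass_ge0 bC) (mass_le bC)
    f0_mass_ge0 msig sig0 t0).
have YI : \int[mu]_(u in `[0%R, t])
      ((2 * lambda * mass b u)%:E * \int[mu]_x mild lambda f0 g0 b u x) =
    \int[mu]_(u in `[0%R, t]) ((2 * lambda * mass b u)%:E * Y u).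
  by apply: eq_integral => u _; rewrite YE.
by rewrite YI YE.
Qed.

(** Met pairs supply [4 * lambda] per pair, and by [pair_budget] the supply plus
    the part held back in free pairs is at most [2 * lambda] times the square
    of the mass. *)
Lemma mild_budget C b t : bounded_density C b -> (0 <= t)%R ->
  \int[mu]_x mild lambda f0 g0 b t x +
  \int[mu]_(u in `[0%R, t])
    ((2 * lambda * mass b u)%:E * \int[mu]_x mild lambda f0 g0 b u x) +
  (4 * lambda)%:E * free_pairs b t <=
  (M0 + 4 * N0)%:E + (2 * lambda)%:E * \int[mu]_(u in `[0%R, t]) (mass b u * mass b u)%:E.
Proof.
move=> bC t0; have [mb b_ge0 _] := bC.
have l2 : (0 <= 2 * lambda)%R by rewrite mulr_ge0// ltW.
have l4 : (0 <= 4 * lambda)%R by rewrite mulr_ge0// ltW.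
set X := \int[mu]_(s in `[0%R, t]) \int[mu]_x collision b b s x.
have X0 : 0 <= X.
  by do 2![apply: integral_ge0 => ? _]; exact: collision_ge0.
have F0 : 0 <= free_pairs b t.
  do 3![apply: integral_ge0 => ? _]; case: ifP => // _.
  by rewrite lee_fin mulr_ge0.
have budget : (4 * lambda)%:E * (X + free_pairs b t) <=
    (2 * lambda)%:E * \int[mu]_(u in `[0%R, t]) (mass b u * mass b u)%:E.
  have -> : (4 * lambda = 2 * lambda + 2 * lambda)%R by ring.
  have XF0 := adde_ge0 X0 F0.
  have l2e : 0 <= (2 * lambda)%:E by rewrite lee_fin.
  rewrite EFinD (ge0_muleDl _ l2e l2e) -(ge0_muleDr _ XF0 XF0).
  by apply: lee_wpmul2l; [rewrite lee_fin|exact: (pair_budget bC t)].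
have bal := leeD2r ((4 * lambda)%:E * free_pairs b t) (mild_balance bC t0).
apply: (le_trans bal).
rewrite (int_sourceE data bC) -/X.
set A := \int[mu]_x (f0 x)%:E; set G := \int[mu]_(s in _) _.
have -> : A + (4%:E * G + (4 * lambda)%:E * X) + (4 * lambda)%:E * free_pairs b t =
    (A + 4%:E * G) + (4 * lambda)%:E * (X + free_pairs b t).
  by rewrite (ge0_muleDr _ X0 F0) !addeA.
apply: leeD budget; rewrite [leRHS]EFinD; apply: leeD; first exact: f0_bound data.
rewrite [leRHS]EFinM; apply: lee_wpmul2l => //.
exact: (int_g0_le data).
Qed.

(* the summand 1 only serves to make the truncation level positive *)
Let K := (M0 + 4 * N0 + 1)%R.
Let M0N0 : (0 <= M0 + 4 * N0)%R.
Proof.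
have N00 : (0 <= N0)%R.
  rewrite -lee_fin (le_trans _ (g0_bound data))// integral_ge0// => y _.
  by rewrite integral_ge0// => x _; rewrite lee_fin (g0_nonneg data).
by rewrite addr_ge0 ?mulr_ge0// -lee_fin (le_trans _ (f0_bound data)).
Qed.
Let K0 : (0 < K)%R. Proof. by rewrite /K ltr_wpDl. Qed.

Let f := picard_limit lambda f0 g0 K.
Let b := truncate K f.
Let fd : density f. Proof. exact: (density_picard_limit data K0). Qed.
Let bK : bounded_density K b. Proof. exact: (bounded_truncate K0 fd). Qed.

Let f_mild t : {ae mu, forall x, (f t x)%:E = mild lambda f0 g0 b t x}.
Proof.
have T0 : (0 <= Num.max 0 t)%R by rewrite le_max lexx.
have tT : (t <= Num.max 0 t)%R by rewrite le_max lexx orbT.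
have mm := measurable_mild data bK.
have int_m : mu.-integrable setT (mild lambda f0 g0 b t).
  apply/integrableP; split; first by meas.
  apply: le_lt_trans (le_lt_trans (int_mild_le data bK T0 tT) (ltry _)).
  rewrite le_eqVlt; apply/orP; left; apply/eqP; apply: eq_integral => x _.
  by rewrite gee0_abs// (mild_ge0 data bK).
have := integrable_ae measurableT int_m.
apply: ae_imply2 (picard_limit_fixpoint data K0 t) => x fE /(_ I) fin.
by rewrite [f t x]fE /truncated_map /mild_map fineK.
Qed.

Let mass_f t : (mass f t)%:E = \int[mu]_x mild lambda f0 g0 b t x.
Proof.
have mm := measurable_mild data bK; have [mf f_ge0 _] := fd.
rewrite (massE fd); apply: ge0_ae_eq_integral; first exact: measurableT.
- by meas.
- by meas.
- by move=> x _; rewrite lee_fin.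
- by move=> x _; exact: (mild_ge0 data bK).
- by apply: ae_imply (f_mild t) => x.
Qed.

Let mass_b_le t : (mass b t <= mass f t)%R.
Proof.
have [mf f_ge0 _] := fd; have [mb _ _] := bK.
rewrite -lee_fin (massE fd) (massE bK).
apply: ge0_le_integral; first exact: measurableT.
- by move=> x _; have [_ b_ge0 _] := bK; rewrite lee_fin.
- by meas.
- by meas.
move=> x _; rewrite lee_fin /b /truncate ler_piMr//.
by rewrite /cutoff ler_pdivrMr ?lt_max ?K0// mul1r le_max lexx.
Qed.

(** The quadratic gain of [mild_budget] cancels against the loss, because the
    truncated density has the smaller mass: [mass b * mass b <= mass b * mass f]. *)
Let budget t : (0 <= t)%R ->
  (mass f t)%:E + (4 * lambda)%:E * free_pairs b t <= (M0 + 4 * N0)%:E.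
Proof.
move=> t0; have l2 : (0 <= 2 * lambda)%R by rewrite mulr_ge0// ltW.
have mb := measurable_mass bK; have mfm := measurable_mass fd.
pose Z := (2 * lambda)%:E * \int[mu]_(u in `[0%R, t]) (mass b u * mass b u)%:E.
have Zfin : Z \is a fin_num.
  rewrite ge0_fin_numE; last first.
    rewrite mule_ge0// integral_ge0// => u _.
    by rewrite lee_fin mulr_ge0 ?(mass_ge0 bK).
  apply: (@le_lt_trans _ _ ((2 * lambda)%:E * (K * K * (t - 0))%:E)).
    apply: lee_wpmul2l => //; rewrite -integral_itv_cst//.
    apply: ge0_le_integral; first exact: measurable_itv.
    - by move=> u _; rewrite lee_fin mulr_ge0 ?(mass_ge0 bK).
    - by apply: measurable_funTS; meas.
    - by apply: measurable_funTS; meas.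
    by move=> u _; rewrite lee_fin ler_pM ?(mass_ge0 bK) ?(mass_le bK).
  by rewrite -EFinM ltry.
rewrite -(leeD2rE _ _ Zfin) addeAC; apply: le_trans (mild_budget bK t0).
rewrite mass_f; apply: leeD => //; apply: leeD => //.
rewrite /Z -ge0_integralZ//; first last.
- by move=> u; rewrite lee_fin mulr_ge0 ?(mass_ge0 bK).
- by meas.
apply: ge0_le_integral; first exact: measurable_itv.
- by move=> u _; rewrite mule_ge0// lee_fin mulr_ge0 ?(mass_ge0 bK).
- by apply: measurable_funTS; meas.
- rewrite [X in measurable_fun _ X](_ : _ =
    fun u => (2 * lambda * mass b u)%:E * (mass f u)%:E).
    by apply: measurable_funTS; meas.
  by apply/funext => u; rewrite mass_f.
move=> u _; rewrite -mass_f -!EFinM lee_fin mulrA.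
by apply: ler_wpM2l; [rewrite mulr_ge0 ?(mass_ge0 bK)|exact: mass_b_le].
Qed.

(** The a priori bound [M0 + 4 * N0] lies below the truncation level, so the
    truncation is inactive on the fixed point.  What is left of the budget
    bounds the free pairs. *)
Lemma exists_mild_density : exists f : R -> R -> R,
  [/\ bounded_density (M0 + 4 * N0) f,
      forall t, {ae mu, forall x, (f t x)%:E = mild lambda f0 g0 f t x} &
      forall t, (0 <= t)%R ->
        (4 * lambda)%:E * free_pairs f t <= (M0 + 4 * N0)%:E].
Proof.
have l4 : (0 <= 4 * lambda)%R by rewrite mulr_ge0// ltW.
have [mf f_ge0 _] := fd; have [mb b_ge0 _] := bK.
have F0 t : 0 <= (4 * lambda)%:E * free_pairs b t.
  rewrite mule_ge0//; do 3![apply: integral_ge0 => ? _]; case: ifP => // _.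
  by rewrite lee_fin mulr_ge0.
have fK t : (mass f t <= M0 + 4 * N0)%R.
  have [t0|/ltW t0] := leP 0%R t.
    by rewrite -lee_fin; apply: le_trans (budget t0); apply: leeDl.
  rewrite -lee_fin mass_f; apply: (le_trans (int_mild_le data bK (lexx 0%R) t0)).
  by rewrite lee_fin mulr0 mulr0 addr0.
have bf : b = f.
  apply/funext => t; apply: truncate_id => //.
  by apply: (le_trans (fK t)); rewrite /K lerDl.
exists f; split.
- by split => // t; rewrite -(massE fd) lee_fin.
- by move=> t; have := f_mild t; rewrite bf.
- move=> t t0; have := budget t0; rewrite bf; apply: le_trans.
  by apply: leeDr; rewrite lee_fin (mass_ge0 fd).
Qed.

End Global.

(** * The density of pairs *)

Section BackFlow.
Context {R : realType}.
Local Notation mu := (@lebesgue_measure R).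

Lemma measurable_sg : measurable_fun setT (@Num.sg R).
Proof.
rewrite [X in measurable_fun _ X](_ : _ =
  fun x => if (0 < x)%R then 1%R else if (x < 0)%R then (- 1)%R else 0%R).
  by meas.
apply/funext => x; case: (ltgtP 0%R x) => [x0|x0|<-].
- by rewrite gtr0_sg.
- by rewrite ltr0_sg.
- by rewrite sgr0.
Qed.

Section one_function.
Variable u : R -> R -> \bar R.
Hypothesis mu_u : measurable_fun setT (fun p : R * R => u p.1 p.2).
Hypothesis u0 : forall x y, 0 <= u x y.

Definition on_back_flow (t : R) (p : R * R) : \bar R :=
  u (back_flow t p).1 (back_flow t p).2.

(** The backward flow moves the two members of a pair apart by [t], so it maps
    the half plane [y < x] onto [y + t < x], by a translation. *)
Definition right_mass (t : R) : \bar R :=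
  \int[mu]_y \int[mu]_x (if (y + t < x)%R then u x y else 0).
Definition left_mass (t : R) : \bar R :=
  \int[mu]_x \int[mu]_y (if (x + t < y)%R then u x y else 0).

Let ite_ge0 (c : bool) x y : 0 <= (if c then u x y else 0).
Proof. by case: c. Qed.

Lemma int_back_flow t :
  \int[mu]_x \int[mu]_y on_back_flow t (x, y) = right_mass t + left_mass t.
Proof.
pose a x y := if (y < x)%R then u (x + t / 2) (y - t / 2) else 0.
pose b x y := if (x < y)%R then u (x - t / 2) (y + t / 2) else 0.
have ma : measurable_fun setT (fun p : R * R => a p.1 p.2) by rewrite /a; meas.
have mb : measurable_fun setT (fun p : R * R => b p.1 p.2) by rewrite /b; meas.
have a0 x y : 0 <= a x y by exact: ite_ge0.
have b0 x y : 0 <= b x y by exact: ite_ge0.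
have msg := measurable_sg.
have mo : measurable_fun setT (fun p : R * R => on_back_flow t p).
  by rewrite /on_back_flow /back_flow/=; meas.
transitivity (\int[mu]_x \int[mu]_y (a x y + b x y)).
  apply: eq_integral => x _; apply: ge0_ae_eq_integral; first exact: measurableT.
  - exact: (measurableT_comp mo (pair1_measurable x)).
  - by meas.
  - by move=> y _; exact: u0.
  - by move=> y _; exact: adde_ge0.
  exists [set x]; split => //; first exact: lebesgue_measure_set1.
  move=> y /= /not_implyP[_]; apply: contra_notP => yx.
  have {}yx : y != x by apply/eqP.
  rewrite /on_back_flow /back_flow /a /b/=.
  case: (ltgtP y x) yx => // [yx _|xy _].
    by rewrite gtr0_sg ?subr_gt0// !mulr1 adde0.
  by rewrite ltr0_sg ?subr_lt0// !mulrN1 opprK add0e.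
have ta : \int[mu]_x \int[mu]_y a x y = right_mass t.
  pose r (y x : R) := if (y + t < x)%R then u x y else 0.
  have mr : measurable_fun setT (fun p : R * R => r p.1 p.2) by rewrite /r; meas.
  have r0 y x : 0 <= r y x by exact: ite_ge0.
  have mI : measurable_fun setT (fun y : R => \int[mu]_x r y x) by exact: measurable_pint.
  have I0 y : 0 <= \int[mu]_x r y x by exact: integral_ge0.
  rewrite (tonelli_swap ma a0).
  apply: etrans (integral_translation (- (t / 2)) mI I0).
  apply: eq_integral => y _.
  have mry : measurable_fun setT (r (y - t / 2)%R) by meas.
  apply: etrans (integral_translation (t / 2) mry (r0 _)).
  apply: eq_integral => x _; rewrite /a /r; congr (if _ then _ else _).
  by apply/idP/idP; lra.
have tb : \int[mu]_x \int[mu]_y b x y = left_mass t.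
  pose r (x y : R) := if (x + t < y)%R then u x y else 0.
  have mr : measurable_fun setT (fun p : R * R => r p.1 p.2) by rewrite /r; meas.
  have r0 x y : 0 <= r x y by exact: ite_ge0.
  have mI : measurable_fun setT (fun x : R => \int[mu]_y r x y) by exact: measurable_pint.
  have I0 x : 0 <= \int[mu]_y r x y by exact: integral_ge0.
  apply: etrans (integral_translation (- (t / 2)) mI I0).
  apply: eq_integral => x _.
  have mrx : measurable_fun setT (r (x - t / 2)%R) by meas.
  apply: etrans (integral_translation (t / 2) mrx (r0 _)).
  apply: eq_integral => y _; rewrite /b /r; congr (if _ then _ else _).
  by apply/idP/idP; lra.
rewrite -ta -tb; exact: (ge0_iterated_integralD ma mb a0 b0).
Qed.

Lemma int_back_flow_le t : \int[mu]_x \int[mu]_y on_back_flow t (x, y) <=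
  2%:E * \int[mu]_y \int[mu]_x u x y.
Proof.
have mI : measurable_fun setT
    (fun y : R => \int[mu]_x (if (y + t < x)%R then u x y else 0)).
  by apply: measurable_pint; [by meas|move=> *; exact: ite_ge0].
have mJ : measurable_fun setT
    (fun x : R => \int[mu]_y (if (x + t < y)%R then u x y else 0)).
  by apply: measurable_pint; [by meas|move=> *; exact: ite_ge0].
have -> : 2%:E = 1 + 1 :> \bar R by rewrite -EFinD.
rewrite int_back_flow ge0_muleDl// mul1e; apply: leeD.
  apply: ge0_le_integral => //.
  - by move=> y _; apply: integral_ge0 => x _; exact: ite_ge0.
  - by apply: measurable_pint => //; meas.
  move=> y _; apply: ge0_le_integral => //; [by meas|by meas|].
  by move=> x _; case: ifP.
rewrite -tonelli_swap//; apply: ge0_le_integral => //.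
- by move=> y _; apply: integral_ge0 => x _; exact: ite_ge0.
- by apply: measurable_pint => //; meas.
move=> x _; apply: ge0_le_integral => //; [by meas|by meas|].
by move=> y _; case: ifP.
Qed.

End one_function.
End BackFlow.

Section PairDensity.
Context {R : realType}.
Local Notation mu := (@lebesgue_measure R).
Local Notation jmeas f := (measurable_fun setT (fun p : R * R => f p.1 p.2)).
Variables (lambda : R) (g0 : R * R -> R) (f : R -> R -> R).
Hypotheses (l0 : (0 < lambda)%R) (fd : density f).
Hypotheses (mg0 : measurable_fun setT g0) (g0_ge0 : forall p, (0 <= g0 p)%R).
Let mf : jmeas f. Proof. by case: fd. Qed.
Let f_ge0 : forall t x, (0 <= f t x)%R. Proof. by case: fd. Qed.

Definition pair_created (s t : R) (p : R * R) : \bar R :=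
  (f s (back_flow (t - s) p).1 * f s (back_flow (t - s) p).2)%:E.

Definition pair_mild (t : R) (p : R * R) : \bar R :=
  (g0 (back_flow t p))%:E +
  lambda%:E * \int[mu]_(s in `[0%R, t]) pair_created s t p.

Let created_ge0 s t p : 0 <= pair_created s t p.
Proof. by rewrite lee_fin mulr_ge0. Qed.

Lemma pair_mild_ge0 t p : 0 <= pair_mild t p.
Proof.
by rewrite adde_ge0 ?lee_fin// mule_ge0 ?integral_ge0// lee_fin ltW.
Qed.

Lemma measurable_pair_mild :
  measurable_fun setT (fun q : R * (R * R) => pair_mild q.1 q.2).
Proof.
have msg := @measurable_sg R.
rewrite /pair_mild; mstep.
  by rewrite /back_flow/=; meas.
mstep; first by meas.
apply: measurable_pint_itv; [by meas|by meas| |by move=> *; exact: created_ge0].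
by rewrite /pair_created /back_flow/=; meas.
Qed.

(** What is created and not yet met at time [t] are the free pairs, once for each
    side of the diagonal. *)
Lemma int_created t :
  \int[mu]_x \int[mu]_y \int[mu]_(s in `[0%R, t]) pair_created s t (x, y) =
  free_pairs f t + free_pairs f t.
Proof.
have msg := @measurable_sg R.
have mc x : measurable_fun setT (fun q : R * R => pair_created q.1 t (x, q.2)).
  by rewrite /pair_created /back_flow/=; meas.
have mc2 : measurable_fun setT
    (fun q : R * R * R => pair_created q.1.1 t (q.1.2, q.2)).
  by rewrite /pair_created /back_flow/=; meas.
transitivity (\int[mu]_x \int[mu]_(s in `[0%R, t]) \int[mu]_y pair_created s t (x, y)).
  apply: eq_integral => x _.
  by rewrite (tonelli_itv 0 t (mc x) (fun s y => created_ge0 s t (x, y))).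
pose k (s x : R) := \int[mu]_y pair_created s t (x, y).
have mk : jmeas k by apply: measurable_pint => // *; exact: created_ge0.
have k0 s x : 0 <= k s x by apply: integral_ge0 => y _; exact: created_ge0.
rewrite (tonelli_itv 0 t mk k0) /free_pairs.
pose h (s : R) := \int[mu]_y \int[mu]_x
    (if (y + (t - s) < x)%R then (f s x * f s y)%:E else 0).
have mh : measurable_fun setT h.
  apply: measurable_pint; last first.
    by move=> s y; apply: integral_ge0 => x _; case: ifP => // _; rewrite lee_fin mulr_ge0.
  apply: measurable_pint; first by meas.
  by move=> q x; case: ifP => // _; rewrite lee_fin mulr_ge0.
have h0 s : 0 <= h s.
  by do 2![apply: integral_ge0 => ? _]; case: ifP => // _; rewrite lee_fin mulr_ge0.
transitivity (\int[mu]_(s in `[0%R, t]) (h s + h s)); last first.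
  by apply: ge0_integralD => //; exact: measurable_funTS.
apply: eq_integral => s _.
pose u (x y : R) := (f s x * f s y)%:E.
have mu_u : measurable_fun setT (fun p : R * R => u p.1 p.2) by rewrite /u; meas.
have u0 x y : 0 <= u x y by rewrite lee_fin mulr_ge0.
apply: (etrans (int_back_flow mu_u u0 (t - s))).
apply: (congr2 adde); first exact: erefl.
apply: eq_integral => x _; apply: eq_integral => y _.
by rewrite /u mulrC.
Qed.

Lemma int_pair_mild_le (N0 K : R) t :
  \int[mu]_y \int[mu]_x (g0 (x, y))%:E <= N0%:E ->
  (4 * lambda)%:E * free_pairs f t <= K%:E ->
  \int[mu]_x \int[mu]_y pair_mild t (x, y) <= (2 * N0 + K)%:E.
Proof.
move=> gN fK; have msg := @measurable_sg R.
pose a (x y : R) : \bar R := (g0 (back_flow t (x, y)))%:E.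
pose b (x y : R) : \bar R := \int[mu]_(s in `[0%R, t]) pair_created s t (x, y).
have ma : jmeas a by rewrite /a /back_flow/=; meas.
have mb : jmeas b.
  apply: measurable_pint_itv; [by meas|by meas| |by move=> *; exact: created_ge0].
  by rewrite /pair_created /back_flow/=; meas.
have a0 x y : 0 <= a x y by rewrite lee_fin.
have b0 x y : 0 <= b x y by apply: integral_ge0 => s _; exact: created_ge0.
have l0' : 0 <= lambda%:E by rewrite lee_fin ltW.
have F0 : 0 <= free_pairs f t.
  by do 3![apply: integral_ge0 => ? _]; case: ifP => // _; rewrite lee_fin mulr_ge0.
have -> : \int[mu]_x \int[mu]_y pair_mild t (x, y) =
  \int[mu]_x \int[mu]_y a x y + lambda%:E * \int[mu]_x \int[mu]_y b x y.
  pose c (x y : R) : \bar R := lambda%:E * b x y.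
  have mc : jmeas c by rewrite /c; meas.
  have c0 x y : 0 <= c x y by exact: mule_ge0.
  have mI : measurable_fun setT (fun x => \int[mu]_y b x y) by exact: measurable_pint.
  have I0 x : 0 <= \int[mu]_y b x y by exact: integral_ge0.
  apply: (etrans (ge0_iterated_integralD ma mc a0 c0)).
  apply: (congr2 adde); first exact: erefl.
  apply: etrans (ge0_integralZ measurableT mI I0 (ltW l0)).
  apply: eq_integral => x _.
  have mbx : measurable_fun setT (b x) by meas.
  exact: (ge0_integralZ measurableT mbx (b0 x) (ltW l0)).
rewrite EFinD; apply: leeD.
  pose u (x y : R) : \bar R := (g0 (x, y))%:E.
  have mu_u : jmeas u by rewrite /u; meas.
  have u0 x y : 0 <= u x y by rewrite lee_fin.
  apply: (le_trans (int_back_flow_le mu_u u0 t)).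
  by rewrite EFinM; apply: lee_wpmul2l.
rewrite int_created; apply: le_trans fK.
have -> : (4 * lambda = lambda + lambda + (lambda + lambda))%R by ring.
have l2 : (0 <= lambda + lambda)%R by rewrite addr_ge0// ltW.
rewrite EFinD ge0_muleDl ?lee_fin// EFinD ge0_muleDl// ge0_muleDr//.
by apply: leeDl; rewrite adde_ge0// mule_ge0.
Qed.

End PairDensity.

(** * Independence of representatives *)

Section AlmostEverywhereEqual.
Context {R : realType}.
Local Notation mu := (@lebesgue_measure R).
Local Notation mu2 := (mu \x mu).
Local Notation jmeas f := (measurable_fun setT (fun p : R * R => f p.1 p.2)).

Lemma ae0_of_integral d (T : measurableType d) (m : {measure set T -> \bar R})
    (D : set T) (h : T -> \bar R) : measurable D ->
  measurable_fun setT h -> (forall x, 0 <= h x) ->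
  \int[m]_(x in D) h x <= 0 -> {ae m, forall x, D x -> h x = 0}.
Proof.
move=> mD mh h0 ih; apply/(ae_eq_integral_abs m mD (measurable_funTS mh)).
have -> : \int[m]_(x in D) `|h x| = \int[m]_(x in D) h x.
  by apply: eq_integral => x _; rewrite gee0_abs.
by apply/eqP; rewrite eq_le ih/= integral_ge0.
Qed.

Lemma measurable_pint_signed d (T : measurableType d) (k : T -> R -> \bar R) :
  measurable_fun setT (fun p : T * R => k p.1 p.2) ->
  measurable_fun setT (fun x => \int[mu]_y k x y).
Proof.
move=> mk; rewrite [X in measurable_fun _ X](_ : _ =
  fun x => \int[mu]_y maxe (k x y) 0 - \int[mu]_y maxe (- k x y) 0); last first.
  apply/funext => x; rewrite integralE; congr (_ - _);
  by apply: eq_integral => y _; rewrite ?funeposE ?funenegE.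
have le_maxr0 (y : \bar R) : 0 <= maxe y 0 by rewrite le_max lexx orbT.
apply: emeasurable_funB.
- apply: (@measurable_pint _ _ _ (fun x y => maxe (k x y) 0)) => //.
  exact: (measurable_maxe mk (measurable_cst _)).
- apply: (@measurable_pint _ _ _ (fun x y => maxe (- k x y) 0)) => //.
  apply: measurable_maxe => //.
  exact: (measurableT_comp (@oppe_measurable _ _) mk).
Qed.

Lemma measurable_pint_itv_signed d (T : measurableType d) (lo hi : T -> R)
    (k : T -> R -> \bar R) :
  measurable_fun setT lo -> measurable_fun setT hi ->
  measurable_fun setT (fun p : T * R => k p.1 p.2) ->
  measurable_fun setT (fun x => \int[mu]_(y in `[lo x, hi x]) k x y).
Proof.
move=> mlo mhi mk; rewrite [X in measurable_fun _ X](_ : _ =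
  fun x => \int[mu]_y (if (lo x <= y <= hi x)%R then k x y else 0)).
  apply: (@measurable_pint_signed _ T
    (fun x y => if (lo x <= y <= hi x)%R then k x y else 0)); by meas.
by apply/funext => x; exact: integral_itv_if.
Qed.

(** Solutions are only constrained at positive times, and time integrals do not
    see the endpoint 0. *)
Lemma integral_itv_pos (F G : R -> \bar R) (s t : R) : (0 <= s)%R ->
  measurable_fun setT G -> (forall r, (0 < r)%R -> F r = G r) ->
  \int[mu]_(r in `[s, t]) F r = \int[mu]_(r in `[s, t]) G r.
Proof.
move=> s0 mG FG.
have FGs : {in `]s, t]%classic, F =1 G}.
  by move=> r; rewrite inE/= in_itv/= => /andP[sr _]; apply: FG; exact: le_lt_trans sr.
have mGs : measurable_fun `]s, t]%classic G by exact: measurable_funTS.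
have mFs : measurable_fun `]s, t]%classic F.
  by apply: eq_measurable_fun mGs => r rs; rewrite FGs.
rewrite -integral_itv_obnd_cbnd// -[RHS]integral_itv_obnd_cbnd//.
exact: eq_integral.
Qed.

Section after_zero.
Variable f : R -> R -> R.
Hypothesis mfpos : measurable_fun [set p : R * R | (0 < p.1)%R]
  (fun p => f p.1 p.2).

(** A solution is measurable on positive times only.  Its extension by 0 is
    measurable everywhere and has the same time integrals. *)
Definition after_zero (t x : R) : R := if (0 < t)%R then f t x else 0%R.

Lemma measurable_after_zero : jmeas after_zero.
Proof.
have mpos : measurable [set p : R * R | (0 < p.1)%R].
  rewrite -[X in measurable X]setTI.
  have mb : measurable_fun setT (fun p : R * R => (0 < p.1)%R) by meas.
  exact: (mb measurableT [set true] I).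
have /(measurable_restrictT _ mpos) := mfpos.
apply: eq_measurable_fun => p _; rewrite patchE /after_zero.
case: ifPn => [|]; first by rewrite inE/= => ->.
by rewrite notin_setE/= => /negP/negbTE ->.
Qed.
Let mff := measurable_after_zero.

Let after_zeroE t x : (0 < t)%R -> f t x = after_zero t x.
Proof. by rewrite /after_zero => ->. Qed.

Lemma damping_after_zero lambda s t : (0 <= s)%R ->
  damping lambda f s t = damping lambda after_zero s t.
Proof.
move=> s0; rewrite /damping; congr (expR (_ * _))%R.
rewrite /Rintegral; congr fine; apply: integral_itv_pos => //.
  rewrite /mass /Rintegral; mstep; apply: measurableT_comp => //.
  by apply: measurable_pint_signed; meas.
by move=> r r0; congr (_%:E); apply: eq_Rintegral => x _; exact: after_zeroE.
Qed.

Lemma collision_after_zero s x : collision f f s x = collision after_zero after_zero s x.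
Proof.
apply: integral_itv_pos => //; first by meas.
by move=> r r0; rewrite !after_zeroE.
Qed.

Lemma pair_created_after_zero t p :
  \int[mu]_(s in `[0%R, t]) pair_created f s t p =
  \int[mu]_(s in `[0%R, t]) pair_created after_zero s t p.
Proof.
have msg := @measurable_sg R.
apply: integral_itv_pos => //.
  by rewrite /pair_created /back_flow/=; meas.
by move=> r r0; rewrite /pair_created !after_zeroE.
Qed.

End after_zero.

Section two_versions.
Variables a b : R -> R -> R.
Hypotheses (ma : jmeas a) (mb : jmeas b).
Hypothesis ab : {ae mu, forall t, {ae mu, forall x, a t x = b t x}}.

Let w (t x : R) : R := `|a t x - b t x|%R.
Let mw : jmeas w. Proof. by rewrite /w; meas. Qed.
Let w_ge0 t x : (0 <= w t x)%R. Proof. exact: normr_ge0. Qed.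
Let w0 t x : 0 <= (w t x)%:E. Proof. by rewrite lee_fin. Qed.
Let wE t x : w t x = 0%R -> a t x = b t x.
Proof. by move/eqP; rewrite normr_eq0 subr_eq0 => /eqP. Qed.

Let wI : {ae mu, forall t, \int[mu]_x (w t x)%:E = 0}.
Proof.
apply: ae_imply ab => t abt.
have mwt : measurable_fun setT (fun x => (w t x)%:E) by meas.
rewrite (ge0_ae_eq_integral (g := cst 0))//; first exact: integral0.
by apply: ae_imply abt => x abx _; rewrite /w abx subrr normr0.
Qed.

Let mwI : measurable_fun setT (fun t => \int[mu]_x (w t x)%:E).
Proof. by apply: measurable_pint => //; meas. Qed.

Let int0 (k : R -> \bar R) (D : set R) : measurable D -> measurable_fun setT k ->
  (forall t, 0 <= k t) -> (forall t, \int[mu]_x (w t x)%:E = 0 -> k t = 0) ->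
  \int[mu]_(t in D) k t = 0.
Proof.
move=> mD mk k0 kw; rewrite (ge0_ae_eq_integral (g := cst 0))//.
- exact: integral0.
- exact: measurable_funTS.
- by apply: ae_imply wI => t /kw.
Qed.

Lemma damping_eq lambda s t : damping lambda a s t = damping lambda b s t.
Proof.
rewrite /damping; congr (expR (_ * _))%R; rewrite /Rintegral; congr fine.
apply: ae_eq_integral => //.
- apply: measurable_funTS; rewrite /mass /Rintegral; mstep.
  by apply: measurableT_comp => //; apply: measurable_pint_signed; meas.
- apply: measurable_funTS; rewrite /mass /Rintegral; mstep.
  by apply: measurableT_comp => //; apply: measurable_pint_signed; meas.
apply: ae_imply ab => r abr _; congr (_%:E); rewrite /mass /Rintegral; congr fine.
apply: ae_eq_integral => //; [by meas|by meas|].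
by apply: ae_imply abr => x -> _.
Qed.

(** The characteristics ending at [x] meet the set where the two versions differ
    as often as [w] collides with the constant density 1.  These collisions
    have total [\int 0 * +oo = 0] by [int_collision_le]. *)
Let meet (s x : R) : \bar R :=
  collision w (fun _ _ => 1%R) s x + collision (fun _ _ => 1%R) w s x.

Let m1 : jmeas (fun _ _ : R => 1%R : R). Proof. by meas. Qed.
Let one0 : forall t x : R, (0 <= (fun _ _ : R => 1%R : R) t x)%R. Proof. by []. Qed.

Let mmeet : measurable_fun setT (fun p : R * R => meet p.1 p.2).
Proof.
have h1 := measurable_collision mw m1 w_ge0 one0.
have h2 := measurable_collision m1 mw one0 w_ge0.
by rewrite /meet; mstep.
Qed.

Let meet_ge0 s x : 0 <= meet s x.
Proof. by apply: adde_ge0; exact: collision_ge0. Qed.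

Let int_meet t : \int[mu]_(s in `[0%R, t]) \int[mu]_x meet s x = 0.
Proof.
have h1 := measurable_collision mw m1 w_ge0 one0.
have h2 := measurable_collision m1 mw one0 w_ge0.
have p1 := collision_ge0 w_ge0 one0; have p2 := collision_ge0 one0 w_ge0.
have mc : measurable_fun setT (fun t : R => (\int[mu]_x (w t x)%:E) * \int[mu]_x (1%R)%:E).
  by meas.
have mc' : measurable_fun setT (fun t : R => (\int[mu]_x (1%R)%:E) * \int[mu]_x (w t x)%:E).
  by meas.
have I1 : 0 <= \int[mu]_x (1%R)%:E by exact: integral_ge0.
have Iw t' : 0 <= \int[mu]_x (w t' x)%:E by exact: integral_ge0.
rewrite /meet (int2D t h1 h2 p1 p2).
apply/eqP; rewrite eq_le; apply/andP; split; last first.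
  by apply: adde_ge0; do 2![apply: integral_ge0 => ? _].
have -> : 0 = 0 + 0 :> \bar R by rewrite adde0.
apply: leeD.
- apply: le_trans (int_collision_le mw m1 w_ge0 one0 t) _.
  rewrite int0//; first by move=> r; exact: mule_ge0.
  by move=> r ->; rewrite mul0e.
- apply: le_trans (int_collision_le m1 mw one0 w_ge0 t) _.
  rewrite int0//; first by move=> r; exact: mule_ge0.
  by move=> r ->; rewrite mule0.
Qed.

Lemma collision_eq t : {ae mu, forall x, {ae mu, forall s, (0 <= s <= t)%R ->
  collision a a s x = collision b b s x}}.
Proof.
have h : \int[mu]_x \int[mu]_(s in `[0%R, t]) meet s x <= 0.
  by rewrite (tonelli_itv 0 t mmeet meet_ge0) int_meet.
have mh : measurable_fun setT (fun x => \int[mu]_(s in `[0%R, t]) meet s x).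
  by apply: measurable_pint_itv => //; meas.
have J0 x : 0 <= \int[mu]_(s in `[0%R, t]) meet s x by exact: integral_ge0.
have := @ae0_of_integral _ _ mu setT _ measurableT mh J0 h.
apply: ae_imply => x /(_ I) hx.
have mx : measurable_fun setT (fun s => meet s x) by meas.
have := @ae0_of_integral _ _ mu _ _ (measurable_itv `[0%R, t]) mx (fun s => meet_ge0 s x).
rewrite hx => /(_ (lexx _)).
apply: ae_imply => s + st; rewrite /= in_itv/= => /(_ st) /eqP.
have p1 := collision_ge0 w_ge0 one0 s x; have p2 := collision_ge0 one0 w_ge0 s x.
rewrite /meet (padde_eq0 p1 p2) => /andP[/eqP e1 /eqP e2].
have n1 : measurable_fun setT (fun r => (w r (x + (s - r) / 2) * 1%R)%:E) by meas.
have n2 : measurable_fun setT (fun r => (1%R * w r (x - (s - r) / 2))%:E) by meas.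
have q1 := @ae0_of_integral _ _ mu _ _ (measurable_itv `[0%R, s]) n1.
have q2 := @ae0_of_integral _ _ mu _ _ (measurable_itv `[0%R, s]) n2.
apply: ae_eq_integral => //.
- by apply: measurable_funTS; meas.
- by apply: measurable_funTS; meas.
apply: ae_imply2 (q1 _ _) (q2 _ _).
- move=> r + + rs => /(_ rs) [] + /(_ rs) [].
  by rewrite mulr1 mul1r => /wE -> /wE ->.
- by move=> r; rewrite mulr1.
- by rewrite -/(collision w (fun _ _ => 1%R) s x) e1.
- by move=> r; rewrite mul1r.
- by rewrite -/(collision (fun _ _ => 1%R) w s x) e2.
Qed.

Lemma damped_collision_eq (D : R -> R) t : measurable_fun setT D ->
  {ae mu, forall x,
    \int[mu]_(s in `[0%R, t]) ((D s)%:E * collision a a s x) =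
    \int[mu]_(s in `[0%R, t]) ((D s)%:E * collision b b s x)}.
Proof.
move=> mD; apply: ae_imply (collision_eq t) => x hx.
have mc (c : R -> R -> R) : jmeas c -> measurable_fun setT (fun s : R => collision c c s x).
  by move=> mc; apply: measurable_pint_itv_signed; [by meas|by meas|by meas].
have mca := mc _ ma; have mcb := mc _ mb.
apply: ae_eq_integral => //.
- by apply: measurable_funTS; meas.
- by apply: measurable_funTS; meas.
by apply: ae_imply hx => s + st; rewrite /= in_itv/= in st => /(_ st) ->.
Qed.

(** Same idea in the plane, where the backward flow carries the functions
    [w s x] and [w s y] and at most doubles their integral 0. *)
Lemma pair_created_eq t : {ae (mu \x mu), forall p,
  \int[mu]_(s in `[0%R, t]) pair_created a s t p =
  \int[mu]_(s in `[0%R, t]) pair_created b s t p}.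
Proof.
have msg := @measurable_sg R.
pose u1 (s x y : R) : \bar R := (w s x)%:E.
pose u2 (s x y : R) : \bar R := (w s y)%:E.
pose K (s : R) (p : R * R) : \bar R :=
  on_back_flow (u1 s) (t - s) p + on_back_flow (u2 s) (t - s) p.
have K0 s p : 0 <= K s p by apply: adde_ge0; exact: w0.
have mK : measurable_fun setT (fun q : R * R * R => K q.2 q.1).
  by rewrite /K /on_back_flow /u1 /u2 /back_flow/=; meas.
have mKp p : measurable_fun setT (K ^~ p).
  by rewrite /K /on_back_flow /u1 /u2 /back_flow/=; meas.
have mu1 s : jmeas (u1 s) by rewrite /u1; meas.
have mu2 s : jmeas (u2 s) by rewrite /u2; meas.
have Kint s : \int[mu]_x (w s x)%:E = 0 -> \int[mu]_x \int[mu]_y K s (x, y) = 0.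
  move=> ws.
  pose o1 (x y : R) := on_back_flow (u1 s) (t - s) (x, y).
  pose o2 (x y : R) := on_back_flow (u2 s) (t - s) (x, y).
  have mo1 : jmeas o1.
    by rewrite /o1 /on_back_flow /u1 /back_flow/=; meas.
  have mo2 : jmeas o2.
    by rewrite /o2 /on_back_flow /u2 /back_flow/=; meas.
  have o10 x y : 0 <= o1 x y by exact: w0.
  have o20 x y : 0 <= o2 x y by exact: w0.
  transitivity (\int[mu]_x \int[mu]_y o1 x y + \int[mu]_x \int[mu]_y o2 x y).
    exact: (ge0_iterated_integralD mo1 mo2 o10 o20).
  apply/eqP; rewrite eq_le; apply/andP; split; last first.
    by apply: adde_ge0; do 2![apply: integral_ge0 => ? _].
  have -> : 0 = 2%:E * 0 + 2%:E * 0 :> \bar R by rewrite mule0 adde0.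
  apply: leeD.
  - apply: le_trans (int_back_flow_le (mu1 s) (fun x y => w0 s x) (t - s)) _.
    by rewrite /u1 ws integral0.
  - apply: le_trans (int_back_flow_le (mu2 s) (fun x y => w0 s y) (t - s)) _.
    by rewrite -(tonelli_swap (mu2 s) (fun x y => w0 s y)) /u2 ws integral0.
have total : \int[mu \x mu]_p \int[mu]_(s in `[0%R, t]) K s p <= 0.
  have mI : measurable_fun setT (fun p : R * R => \int[mu]_(s in `[0%R, t]) K s p).
    by apply: measurable_pint_itv => //; meas.
  rewrite fubini_tonelli1//; last by move=> p; exact: integral_ge0.
  rewrite /fubini_F.
  have mx x : jmeas (fun s y : R => K s (x, y)).
    by rewrite /K /on_back_flow /u1 /u2 /back_flow/=; meas.
  have ms : jmeas (fun s x : R => \int[mu]_y K s (x, y)).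
    apply: measurable_pint => //.
    by rewrite /K /on_back_flow /u1 /u2 /back_flow/=; meas.
  have -> : \int[mu]_x \int[mu]_y \int[mu]_(s in `[0%R, t]) K s (x, y) =
      \int[mu]_(s in `[0%R, t]) \int[mu]_x \int[mu]_y K s (x, y).
    transitivity (\int[mu]_x \int[mu]_(s in `[0%R, t]) \int[mu]_y K s (x, y)).
      by apply: eq_integral => x _; rewrite (tonelli_itv 0 t (mx x)).
    by rewrite (tonelli_itv 0 t ms)// => *; exact: integral_ge0.
  rewrite int0//; last first.
    by move=> s; apply: integral_ge0 => x _; exact: integral_ge0.
  by apply: measurable_pint => // *; exact: integral_ge0.
have mI : measurable_fun setT (fun p : R * R => \int[mu]_(s in `[0%R, t]) K s p).
  by apply: measurable_pint_itv => //; meas.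
have J0 p : 0 <= \int[mu]_(s in `[0%R, t]) K s p by exact: integral_ge0.
have := @ae0_of_integral _ _ (mu \x mu) setT _ measurableT mI J0 total.
apply: ae_imply => p /(_ I) hp.
have := @ae0_of_integral _ _ mu _ _ (measurable_itv `[0%R, t]) (mKp p) (K0 ^~ p).
rewrite hp => /(_ (lexx _)) hs.
apply: ae_eq_integral => //.
- by apply: measurable_funTS; rewrite /pair_created /back_flow/=; meas.
- by apply: measurable_funTS; rewrite /pair_created /back_flow/=; meas.
apply: ae_imply hs => s + st => /(_ st) /eqP; rewrite /K /on_back_flow /u1 /u2.
rewrite padde_eq0// => /andP[/eqP[] /wE e1 /eqP[] /wE e2].
by rewrite /pair_created e1 e2.
Qed.

End two_versions.
End AlmostEverywhereEqual.

Section IntegrableVersions.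
Context {R : realType} d (T : measurableType d) (m : {measure set T -> \bar R}).

Lemma L1_plusP (u : T -> R) : L1_plus m u ->
  [/\ measurable_fun setT u, \int[m]_x (`|u x|%R)%:E < +oo &
      {ae m, forall x, u x = `|u x|%R}].
Proof.
move=> [/Lfun1_integrable ui u0]; split.
- by apply/measurable_EFinP; exact: measurable_int ui.
- by move/integrableP : ui => [_].
- by apply: ae_imply u0 => x ux; rewrite ger0_norm.
Qed.

Lemma L1_plus_nonneg (u : T -> R) : measurable_fun setT u ->
  (forall x, 0 <= u x)%R -> \int[m]_x (u x)%:E < +oo -> L1_plus m u.
Proof.
move=> mu_ u0 ui; split; last exact: aeW.
apply/Lfun1_integrable/integrableP; split; first exact/measurable_EFinP.
apply: le_lt_trans ui; rewrite le_eqVlt; apply/orP; left; apply/eqP.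
by apply: eq_integral => x _ /=; rewrite ger0_norm.
Qed.

End IntegrableVersions.

Section DatumVersions.
Context {R : realType}.
Local Notation mu := (@lebesgue_measure R).
Variables g0 g1 : R * R -> R.
Hypotheses (mg0 : measurable_fun setT g0) (mg1 : measurable_fun setT g1).
Hypothesis g01 : {ae (mu \x mu), forall p, g0 p = g1 p}.

Let w (p : R * R) : R := `|g0 p - g1 p|%R.
Let mw : measurable_fun setT w. Proof. by rewrite /w; meas. Qed.
Let w_ge0 p : (0 <= w p)%R. Proof. exact: normr_ge0. Qed.
Let w0 p : 0 <= (w p)%:E. Proof. by rewrite lee_fin. Qed.
Let wE p : w p = 0%R -> g0 p = g1 p.
Proof. by move/eqP; rewrite normr_eq0 subr_eq0 => /eqP. Qed.

Let wI : \int[mu]_y \int[mu]_x (w (x, y))%:E = 0.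
Proof.
have mW : measurable_fun setT (fun p => (w p)%:E) by meas.
transitivity (\int[mu \x mu]_p (w p)%:E); first by rewrite fubini_tonelli2.
rewrite (ge0_ae_eq_integral (g := cst 0))//; first exact: integral0.
by apply: ae_imply g01 => p gp _; rewrite /w gp subrr normr0.
Qed.

(** The difference of the two versions is itself an initial pair density of mass
    0, and [int_g0_le] applies to it. *)
Lemma datum_diagonal_eq (D : R -> R) (t : R) :
  measurable_fun setT D -> {ae mu, forall x,
  \int[mu]_(s in `[0%R, t]) (D s * g0 (x + s / 2, x - s / 2))%:E =
  \int[mu]_(s in `[0%R, t]) (D s * g1 (x + s / 2, x - s / 2))%:E}.
Proof.
move=> mD; pose k (s x : R) : \bar R := (w (x + s / 2, x - s / 2))%:E.
have mk : measurable_fun setT (fun p : R * R => k p.1 p.2) by rewrite /k; meas.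
have k0 s x : 0 <= k s x by exact: w0.
have data0 : initial_data 1 (fun _ => 0%R) w 0 0.
  by split => //; rewrite ?integral0// wI.
have total : \int[mu]_x \int[mu]_(s in `[0%R, t]) k s x <= 0.
  by rewrite (tonelli_itv 0 t mk k0); exact: (int_g0_le data0).
have mI : measurable_fun setT (fun x => \int[mu]_(s in `[0%R, t]) k s x).
  by apply: measurable_pint_itv => //; meas.
have J0 x : 0 <= \int[mu]_(s in `[0%R, t]) k s x by exact: integral_ge0.
have := @ae0_of_integral _ _ _ mu setT _ measurableT mI J0 total.
apply: ae_imply => x /(_ I) hx.
have mkx : measurable_fun setT (k ^~ x) by rewrite /k; meas.
have := @ae0_of_integral _ _ _ mu _ _ (measurable_itv `[0%R, t]) mkx (k0 ^~ x).
rewrite hx => /(_ (lexx _)) hs.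
apply: ae_eq_integral => //; [by apply: measurable_funTS; meas..|].
by apply: ae_imply hs => s + st => /(_ st) [] /wE ->.
Qed.

Lemma datum_flow_eq (t : R) :
  {ae (mu \x mu), forall p, g0 (back_flow t p) = g1 (back_flow t p)}.
Proof.
have msg := @measurable_sg R.
pose u (x y : R) : \bar R := (w (x, y))%:E.
have mu_u : measurable_fun setT (fun p : R * R => u p.1 p.2) by rewrite /u; meas.
have u0 x y : 0 <= u x y by exact: w0.
have mo : measurable_fun setT (fun p : R * R => on_back_flow u t p).
  by rewrite /on_back_flow /u /back_flow/=; meas.
have total : \int[mu \x mu]_p on_back_flow u t p <= 0.
  rewrite fubini_tonelli1//; last by move=> p; exact: u0.
  by apply: (le_trans (int_back_flow_le mu_u u0 t)); rewrite wI mule0.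
have o0 p : 0 <= on_back_flow u t p by exact: u0.
have := @ae0_of_integral _ _ _ (mu \x mu) setT _ measurableT mo o0 total.
apply: ae_imply => p /(_ I) ow; apply: wE; apply: EFin_inj.
transitivity (on_back_flow u t p); last exact: ow.
by rewrite /on_back_flow /u; case: (back_flow t p).
Qed.

End DatumVersions.

Section Equations.
Context {R : realType}.
Local Notation mu := (@lebesgue_measure R).
Local Notation jmeas f := (measurable_fun setT (fun p : R * R => f p.1 p.2)).
Variables (lambda : R) (f0 f1 : R -> R) (g0 g1 : R * R -> R) (M0 N0 : R).
Hypothesis data : initial_data lambda f1 g1 M0 N0.
Hypothesis mg0 : measurable_fun setT g0.
Hypothesis f01 : {ae mu, forall x, f0 x = f1 x}.
Hypothesis g01 : {ae (mu \x mu), forall p, g0 p = g1 p}.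

Variables (C : R) (f h : R -> R -> R).
Hypothesis mf : measurable_fun [set p : R * R | (0 < p.1)%R]
  (fun p => f p.1 p.2).
Hypothesis hC : bounded_density C h.
Hypothesis fh : {ae mu, forall t, (0 < t)%R -> {ae mu, forall x, f t x = h t x}}.

Let mg1 : measurable_fun setT g1. Proof. exact: (measurable_g0 data). Qed.
Let g1_ge0 p : (0 <= g1 p)%R. Proof. exact: (g0_nonneg data). Qed.
Let l4 : (0 <= 4 * lambda)%R.
Proof. by rewrite mulr_ge0// ltW// (coupling_gt0 data). Qed.
Let mh : jmeas h. Proof. by case: hC. Qed.
Let h_ge0 : forall t x, (0 <= h t x)%R. Proof. by case: hC. Qed.
Let mhpos : measurable_fun [set p : R * R | (0 < p.1)%R] (fun p => h p.1 p.2).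
Proof. exact: measurable_funTS. Qed.
Let ma : jmeas (after_zero f). Proof. exact: measurable_after_zero. Qed.
Let mb : jmeas (after_zero h). Proof. exact: measurable_after_zero. Qed.
Let ab : {ae mu, forall t, {ae mu, forall x, after_zero f t x = after_zero h t x}}.
Proof.
apply: ae_imply fh => t; rewrite /after_zero.
by case: (0 < t)%R => [/(_ isT)//|_]; exact: aeW.
Qed.

Let damping_fh s t : (0 <= s)%R -> damping lambda f s t = damping lambda h s t.
Proof.
move=> s0; transitivity (damping lambda (after_zero f) s t).
  exact: (damping_after_zero mf lambda t s0).
transitivity (damping lambda (after_zero h) s t).
  exact: (damping_eq ma mb ab lambda s t).
exact/esym/(damping_after_zero mhpos lambda t s0).
Qed.

Lemma mildE t x : mild lambda f1 g1 h t x =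
  (damping lambda h 0 t * f1 x)%:E +
  4%:E * \int[mu]_(s in `[0%R, t])
    (damping lambda h s t * g1 (x + s / 2, x - s / 2))%:E +
  (4 * lambda)%:E * \int[mu]_(s in `[0%R, t])
    ((damping lambda h s t)%:E * collision h h s x).
Proof.
have md := measurable_damping hC lambda.
have mc := measurable_collision mh mh h_ge0 h_ge0.
have c0 := collision_ge0 h_ge0 h_ge0.
have d0 s : 0 <= (damping lambda h s t)%:E by rewrite lee_fin expR_ge0.
pose G (s : R) := (damping lambda h s t * g1 (x + s / 2, x - s / 2))%:E.
pose K (s : R) := (damping lambda h s t)%:E * collision h h s x.
have mG : measurable_fun setT G by rewrite /G; meas.
have mK : measurable_fun setT K by rewrite /K; meas.
have G0 s : 0 <= G s by rewrite lee_fin mulr_ge0// expR_ge0.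
have K0 s : 0 <= K s by rewrite mule_ge0.
rewrite /mild -addeA; congr (_ + _).
transitivity (\int[mu]_(s in `[0%R, t]) (4%:E * G s + (4 * lambda)%:E * K s)).
  apply: eq_integral => s _; rewrite /source /G /K ge0_muleDr//.
  - by rewrite [in RHS]EFinM !muleA; congr (_ * _ + _ * _); exact: muleC.
  - by rewrite mule_ge0// lee_fin.
  - by rewrite mule_ge0// lee_fin.
rewrite ge0_integralD; first last.
- by apply: measurable_funTS; meas.
- by move=> s _; apply: mule_ge0 => //; rewrite lee_fin.
- by apply: measurable_funTS; meas.
- by move=> s _; apply: mule_ge0 => //; rewrite lee_fin.
- exact: measurable_itv.
by rewrite !ge0_integralZ.
Qed.

(** The right-hand side in the form of [mild_f], for arbitrary representatives. *)
Definition density_rhs (f0 : R -> R) (g0 : R * R -> R) (f : R -> R -> R) (t x : R) : \bar R :=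
  (damping lambda f 0 t * f0 x)%:E
  + 4%:E * \int[mu]_(s in `[0%R, t])
      (damping lambda f s t * g0 (x + s / 2, x - s / 2))%:E
  + (4 * lambda)%:E * \int[mu]_(s in `[0%R, t])
      ((damping lambda f s t)%:E * collision f f s x).

(** Passing to other representatives of the data and of the density changes
    neither the damping factors nor the time integrals along almost every
    characteristic. *)
Lemma density_rhs_eq t :
  {ae mu, forall x, density_rhs f0 g0 f t x = mild lambda f1 g1 h t x}.
Proof.
have md := measurable_damping hC lambda.
have mD : measurable_fun setT (fun s => damping lambda h s t) by meas.
have H1 := datum_diagonal_eq mg0 mg1 g01 t mD.
have H2 := damped_collision_eq ma mb ab t mD.
have H01 := ae_imply2 (fun x => @conj _ _) f01 H1.
apply: ae_imply2 H2 H01 => x h2 [h0 h1].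
rewrite [RHS](mildE t x) /density_rhs.
apply: (congr2 adde); first apply: (congr2 adde).
- by rewrite h0 (@damping_fh 0%R t (lexx _)).
- congr (_ * _); rewrite -h1; apply: eq_integral => s.
  by rewrite inE/= in_itv/= => /andP[s0 _]; rewrite (@damping_fh s t s0).
apply: (congr1 (mule (4 * lambda)%:E)).
transitivity (\int[mu]_(s in `[0%R, t]) ((damping lambda h s t)%:E *
    collision (after_zero h) (after_zero h) s x)).
  apply: etrans h2; apply: eq_integral => s; rewrite inE/= in_itv/= => /andP[s0 _].
  by rewrite (@damping_fh s t s0) (collision_after_zero mf).
by apply: eq_integral => s _; rewrite (collision_after_zero mhpos).
Qed.

Lemma pair_rhs_eq t : {ae (mu \x mu), forall p,
  pair_mild lambda g0 f t p = pair_mild lambda g1 h t p}.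
Proof.
have H1 := datum_flow_eq mg0 mg1 g01 t.
have H2 := pair_created_eq ma mb ab t.
apply: ae_imply2 H1 H2 => p h1 h2; rewrite /pair_mild h1.
by rewrite (pair_created_after_zero mf) h2 -(pair_created_after_zero mhpos).
Qed.

End Equations.

(** * Existence and uniqueness *)

Section Solution.
Context {R : realType}.
Local Notation mu := (@lebesgue_measure R).
Local Notation jmeas f := (measurable_fun setT (fun p : R * R => f p.1 p.2)).
Variables (lambda : R) (f0 f1 : R -> R) (g0 g1 : R * R -> R) (M0 N0 : R).
Hypothesis data : initial_data lambda f1 g1 M0 N0.
Hypothesis mg0 : measurable_fun setT g0.
Hypothesis f01 : {ae mu, forall x, f0 x = f1 x}.
Hypothesis g01 : {ae (mu \x mu), forall p, g0 p = g1 p}.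
Let l0 : (0 < lambda)%R. Proof. exact: (coupling_gt0 data). Qed.
Let mg1 : measurable_fun setT g1. Proof. exact: (measurable_g0 data). Qed.
Let g1_ge0 p : (0 <= g1 p)%R. Proof. exact: (g0_nonneg data). Qed.

Variable f : R -> R -> R.
Let K := (M0 + 4 * N0)%R.
Hypothesis fK : bounded_density K f.
Hypothesis f_mild :
  forall t, {ae mu, forall x, (f t x)%:E = mild lambda f1 g1 f t x}.
Hypothesis f_pairs : forall t, (0 <= t)%R ->
  (4 * lambda)%:E * free_pairs f t <= K%:E.
Let mf : jmeas f. Proof. by case: fK. Qed.
Let f_ge0 : forall t x, (0 <= f t x)%R. Proof. by case: fK. Qed.
Let mfpos : measurable_fun [set p : R * R | (0 < p.1)%R] (fun p => f p.1 p.2).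
Proof. exact: measurable_funTS. Qed.

Let g (t : R) (p : R * R) : R := fine (pair_mild lambda g1 f t p).

Let mg : measurable_fun setT (fun q : R * (R * R) => g q.1 q.2).
Proof.
have mp := measurable_pair_mild lambda fK mg1.
by rewrite /g; mstep.
Qed.

Let pm0 t p : 0 <= pair_mild lambda g1 f t p.
Proof. by apply: pair_mild_ge0 => //; exact: fK. Qed.

Let mpm t : measurable_fun setT (pair_mild lambda g1 f t).
Proof.
exact: (measurableT_comp (measurable_pair_mild lambda fK mg1)
  (pair1_measurable t)).
Qed.

Let int_pm t : (0 <= t)%R ->
  \int[mu \x mu]_p pair_mild lambda g1 f t p <= (2 * N0 + K)%:E.
Proof.
move=> t0; rewrite (@fubini_tonelli1 _ _ _ _ _ mu mu _ (mpm t) (pm0 t)).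
exact: (int_pair_mild_le l0 fK mg1 g1_ge0 (g0_bound data) (f_pairs t0)).
Qed.

Let pm_fin t : (0 <= t)%R ->
  {ae (mu \x mu), forall p, (g t p)%:E = pair_mild lambda g1 f t p}.
Proof.
move=> t0.
have /(integrable_ae measurableT) : (mu \x mu).-integrable setT (pair_mild lambda g1 f t).
  apply/integrableP; split; first exact: mpm.
  under eq_integral => p _ do rewrite gee0_abs//.
  by apply: (le_lt_trans (int_pm t0)); rewrite ltry.
by apply: ae_imply => p /(_ I) pf; rewrite /g fineK.
Qed.

(** Given [f], the second equation is an explicit formula for [g].  Its integral
    is finite by the bound on free pairs, so it is finite almost everywhere. *)
Lemma mild_solution_of_density : exists g', mild_solution lambda f0 g0 f g' /\
  forall t, (0 <= t)%R -> {ae (mu \x mu), forall p, (g' t p)%:E = pair_mild lambda g1 f t p}.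
Proof.
have fh : {ae mu, forall t, (0 < t)%R -> {ae mu, forall x, f t x = f t x}}.
  by apply: aeW => t _; exact: aeW.
have g_ge0 t p : (0 <= g t p)%R by apply: fine_ge0.
have int_g t : (0 <= t)%R -> \int[mu \x mu]_p (g t p)%:E <= (2 * N0 + K)%:E.
  move=> t0; apply: le_trans (int_pm t0); apply: ge0_le_integral => //.
  - by move=> p _; rewrite lee_fin.
  - apply/measurable_EFinP; exact: (measurableT_comp mg (pair1_measurable t)).
  - exact: mpm.
  - by move=> p _; apply: fine_le_ge0.
exists g; split => //; split.
- split => //.
  + apply: aeW => t _; apply: L1_plus_nonneg => //; first by meas.
    by case: (fK) => _ _ /(_ t) h; apply: (le_lt_trans h); rewrite ltry.
  + exists K; apply: aeW => t _; rewrite Lnorm1.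
    case: (fK) => _ _ /(_ t); apply: le_trans.
    rewrite le_eqVlt; apply/orP; left; apply/eqP.
    by apply: eq_integral => x _ /=; rewrite ger0_norm.
- split.
  + exact: measurable_funTS.
  + apply: aeW => t t0; apply: L1_plus_nonneg => //.
      exact: (measurableT_comp mg (pair1_measurable t)).
    by apply: (le_lt_trans (int_g _ (ltW t0))); rewrite ltry.
  + exists (2 * N0 + K)%R; apply: aeW => t t0; rewrite Lnorm1.
    apply: le_trans (int_g _ (ltW t0)).
    rewrite le_eqVlt; apply/orP; left; apply/eqP.
    by apply: eq_integral => x _ /=; rewrite ger0_norm.
- apply: aeW => t t0.
  have H := density_rhs_eq data mg0 f01 g01 mfpos fK fh t.
  by apply: ae_imply2 H (f_mild t) => x h ->; rewrite -h.
- apply: aeW => t t0.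
  have H := pair_rhs_eq data mg0 g01 mfpos fK fh t.
  by apply: ae_imply2 H (pm_fin (ltW t0)) => p h ->; rewrite -h.
Qed.

Section uniqueness.
Variable u : R -> R -> R.
Hypothesis u_L1 : Linfty_L1_plus mu u.
Hypothesis u_mild : mild_f lambda f0 g0 u.

Let mu_pos : measurable_fun [set p : R * R | (0 < p.1)%R] (fun p => u p.1 p.2).
Proof. by case: u_L1. Qed.

(** Nonnegativity and the mass bound are imposed at every time and place by
    changing [u] on a null set of times and by taking absolute values. *)
Lemma nice_version : exists C h, bounded_density C h /\
  {ae mu, forall t, (0 < t)%R -> {ae mu, forall x, u t x = h t x}}.
Proof.
have [_ u1 [C0 uC]] := u_L1; pose C := Num.max 0%R C0.
pose a (t x : R) : R := `|after_zero u t x|%R.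
have ma : jmeas a.
  by have := measurable_after_zero mu_pos => mz; rewrite /a; meas.
pose I (t : R) := \int[mu]_x (a t x)%:E.
have mI : measurable_fun setT (fun t => I t <= C%:E).
  apply: (@measurable_fun_lee _ _ _ _ I (cst C%:E)); last exact: measurable_cst.
  apply: measurable_pint; first by meas.
  by move=> t x; rewrite lee_fin; exact: normr_ge0.
exists C, (fun t x => if I t <= C%:E then a t x else 0%R); split.
  split.
  - by apply: measurable_fun_ifT; [exact: (measurableT_comp mI measurable_fst)|by meas|by meas].
  - by move=> t x; case: ifP => // _; exact: normr_ge0.
  - move=> t; have [//|_] := boolP (I t <= C%:E).
    by rewrite integral0 lee_fin /C le_max lexx.
apply: ae_imply2 u1 uC => t /[swap] utC /[swap] t0 /(_ t0) /L1_plusP[_ _ uabs].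
have It : I t <= C%:E.
  apply: (@le_trans _ _ C0%:E); last by rewrite lee_fin /C le_max lexx orbT.
  apply: le_trans (utC t0); rewrite Lnorm1 /I /a /after_zero t0.
  by rewrite le_eqVlt; apply/orP; left; apply/eqP; exact: eq_integral.
by apply: ae_imply uabs => x ux; rewrite It /a /after_zero t0.
Qed.

(** Both densities are fixed points of [mild_map] with masses below a common
    bound, so their distance satisfies a homogeneous Volterra inequality on
    every [[0, t]]; iterating it forces the distance to vanish. *)
Lemma mild_density_unique :
  {ae mu, forall t, (0 < t)%R -> {ae mu, forall x, u t x = f t x}}.
Proof.
have [C' [h [hC' uh]]] := nice_version.
pose C := Num.max C' K.
have bound (b : R -> R -> R) B : bounded_density B b -> (B <= C)%R -> bounded_density C b.
  by move=> [? ? bB] BC; split => // t; apply: (le_trans (bB t)); rewrite lee_fin.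
have hC : bounded_density C h by apply: (bound _ _ hC'); rewrite /C le_max lexx.
have fC : bounded_density C f by apply: (bound _ _ fK); rewrite /C le_max lexx orbT.
have mh : jmeas h by case: hC.
pose P t := t <> 0%R /\
  ((0 < t)%R -> {ae mu, forall x, h t x = mild_map lambda f1 g1 h t x}).
have aeP : {ae mu, forall t, P t}.
  have ne0 : {ae mu, forall t : R, t <> 0%R}.
    exists [set 0%R]; split => //; first exact: lebesgue_measure_set1.
    by move=> t /= /contrapT.
  apply: ae_imply2 ne0 (ae_imply2 (fun x => @conj _ _) uh u_mild) => t tn [ut um].
  split=> // t0.
  have H := density_rhs_eq data mg0 f01 g01 mu_pos hC uh t.
  apply: ae_imply2 (ut t0) (ae_imply2 (fun x => @conj _ _) H (um t0)) => x e [e1 e2].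
  by rewrite /mild_map -e1 -[density_rhs _ _ _ _ _ _]e2 -e.
have contract t T : P t -> (0 <= t <= T)%R ->
    dist1 h f t <= (2 * lip_const lambda M0 N0 C T)%:E *
      \int[mu]_(s in `[0%R, t]) dist1 h f s.
  move=> [tn ht] /andP[t0 tT].
  have {}ht := ht (_ : 0 < t)%R.
  have tpos : (0 < t)%R by rewrite lt_neqAle t0 andbT eq_sym; apply/eqP.
  have {}ht := ht tpos.
  have T0 := le_trans t0 tT.
  apply: le_trans (mild_map_contract data T0 tT hC fC).
  rewrite le_eqVlt; apply/orP; left; apply/eqP; rewrite /dist1.
  have mH := measurable_mild_map data hC; have mF := measurable_mild_map data fC.
  apply: ae_eq_integral => //; [by meas|by meas|].
  apply: ae_imply2 ht (f_mild t) => x e1 e2 _.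
  have e3 : mild_map lambda f1 g1 f t x = f t x by rewrite /mild_map -e2.
  by rewrite e3 -e1.
have md : measurable_fun setT (dist1 h f) by exact: measurable_dist1.
have d_le s : dist1 h f s <= (C + C)%:E.
  rewrite EFinD; case: (hC) => _ h0 hb; case: (fC) => _ _ fb.
  apply: le_trans (leeD (hb s) (fb s)); rewrite -ge0_integralD//.
  - apply: ge0_le_integral => //; [by meas|by meas|].
    move=> x _; rewrite -EFinD lee_fin (le_trans (ler_normB _ _))//.
    by rewrite !ger0_norm.
  - by move=> x _; rewrite lee_fin.
  - by meas.
  - by move=> x _; rewrite lee_fin.
  - by meas.
apply: ae_imply2 (aeP) uh => t Pt uht t0.
suff hf : {ae mu, forall x, h t x = f t x}.
  by apply: ae_imply2 hf (uht t0) => x <-.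
have C0 := bound_ge0 fC.
pose c := (2 * lip_const lambda M0 N0 C t + 1)%R.
have L0 : (0 <= 2 * lip_const lambda M0 N0 C t)%R.
  by rewrite mulr_ge0// (lip_const_ge0 data fC)// ltW.
have c0 : (0 < c)%R by rewrite ltr_wpDl.
apply: (dist1_eq0 mh mf).
apply: (@le0_of_geometric _ _ ((C + C) * expR (2 * c * t))) => n.
rewrite mulrAC; apply: (@volterra_decay _ P (fun _ => dist1 h f) (C + C) c t) => //.
- by rewrite addr_ge0.
- by move=> _ s; exact: dist1_ge0.
- move=> _ s Ps st; apply: (le_trans (contract s t Ps st)).
  apply: lee_wpmul2r; last by rewrite lee_fin /c lerDl.
  by apply: integral_ge0 => r _; exact: dist1_ge0.
- by rewrite (ltW t0) lexx.
Qed.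

End uniqueness.
End Solution.

Local Close Scope ereal_scope.

Theorem theorem7 (R : realType) (lambda : R) (f0 : R -> R) (g0 : R * R -> R) :
  0 < lambda -> L1_plus (leb R) f0 -> L1_plus (leb2 R) g0 ->
  exists (f : R -> R -> R) (g : R -> R * R -> R),
    mild_solution lambda f0 g0 f g /\
    (forall (f' : R -> R -> R) (g' : R -> R * R -> R),
       mild_solution lambda f0 g0 f' g' ->
       eq_Linfty_L1 (leb R) f' f /\ eq_Linfty_L1 (leb2 R) g' g).
Proof.
move=> l0 /L1_plusP[mf0 f0fin f01] /L1_plusP[mg0 g0fin g01].
pose f1 x := `|f0 x|; pose g1 p := `|g0 p|.
have [M0 f1M] : exists M0 : R, (\int[leb R]_x (f1 x)%:E <= M0%:E)%E.
  exists (fine (\int[leb R]_x (f1 x)%:E)%E); rewrite fineK// ge0_fin_numE//.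
  by apply: integral_ge0 => x _; rewrite lee_fin normr_ge0.
have mg1 : measurable_fun setT (fun p => (g1 p)%:E) by rewrite /g1; meas.
have [N0 g1N] : exists N0 : R,
    (\int[leb R]_y \int[leb R]_x (g1 (x, y))%:E <= N0%:E)%E.
  exists (fine (\int[leb2 R]_p (g1 p)%:E)%E); rewrite fineK; last first.
    by rewrite ge0_fin_numE//; apply: integral_ge0 => p _; rewrite lee_fin normr_ge0.
  by rewrite fubini_tonelli2// => p; rewrite lee_fin normr_ge0.
have data : initial_data lambda f1 g1 M0 N0.
  split => //; [by rewrite /f1; meas|by move=> x; exact: normr_ge0| |].
    by rewrite /g1; meas.
  by move=> p; exact: normr_ge0.
have [f [fK f_mild f_pairs]] := exists_mild_density data.
have [g [sol gE]] := mild_solution_of_density data mg0 f01 g01 fK f_mild f_pairs.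
exists f, g; split=> // f' g' [f'_L1 _ f'_mild g'_mild].
have ff := mild_density_unique data mg0 f01 g01 fK f_mild f'_L1 f'_mild.
split.
  by apply: ae_imply ff => t fft t0; apply: ae_imply (fft t0) => x ->.
have [mf' _ _] := f'_L1.
apply: ae_imply g'_mild => t g't t0.
have H := pair_rhs_eq data mg0 g01 mf' fK ff t.
have Hg := ae_imply2 (fun p => @conj _ _) H (gE t (ltW t0)).
apply: ae_imply2 (g't t0) Hg => p e1 [e2 e3] _.
by apply: EFin_inj; rewrite e3 -e2.
Qed.
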